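(* Let $\Lambda$ be a positive definite lattice of dimension $N$ with bilinear form $B$ and quadratic form $Q(y)=B(y,y)$, let $1\le P\le N$, let $c_1,\dots,c_P\in\Lambda\otimes\mathbb{R}$ be linearly independent vectors, and let $x\in\Lambda\otimes\mathbb{R}$. Assume that the real variables $v_{j,k,\dots,m,n}$ (defined in the context from $\{c_l\}$ and $x$) are non-vanishing for all sequences $j,k,\dots,m,n$ of distinct indices in $\{1,\dots,P\}$. Then the generalized complementary error function $M_P$ equals the sum of $P!$ iterated integrals $$M_P(\{c_l\},x;\Lambda)=\sum_{\sigma\in\mathrm{Sym}(P)} m_P\big(v_{\sigma_1},\,v_{\sigma_1,\sigma_2},\,\dots,\,v_{\sigma_1,\sigma_2,\dots,\sigma_P}\big),$$ where the sum runs over all permutations $\sigma=(\sigma_1,\dots,\sigma_P)$ of $\{1,\dots,P\}$.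
   Context: Generalized complementary error function. For linearly independent $c_1,\dots,c_P\in\Lambda\otimes\mathbb{R}$ let $\langle c_1,\dots,c_P\rangle$ be their real span, $x^{||}$ the $B$-orthogonal projection of $x$ to this span, and $c_1^\star,\dots,c_P^\star$ the dual vectors in this span, i.e. $B(c_i,c_j^\star)=\delta_{ij}$. Let $\Delta(\{c_l^\star\})$ be the determinant of the Gram matrix $(B(c_j^\star,c_k^\star))_{j,k}$. Then $$M_P(\{c_l\},x;\Lambda)=\sqrt{\Delta(\{c_l^\star\})}\left(\frac{i}{\pi}\right)^P\int_{\langle c_1,\dots,c_P\rangle-ix^{||}}\ \prod_{l=1}^P\frac{1}{B(c_l^\star,y)}\;e^{-\pi Q(y)-2\pi i B(y,x)}\,d^Py,$$ where $B,Q$ are extended complex-bilinearly and $d^Py$ is the Euclidean measure, i.e. Lebesgue measure in coordinates with respect to an orthonormal basis of the span. (The integral is defined when $B(c_l^\star,x)\neq0$ for all $l$.) Variables $v$. Define the vectors $c_{n\perp m,l,\dots,k,j}$ (distinct indices) recursively by $c_{l\perp j}=c_l-\frac{B(c_l,c_j)}{Q(c_j)}c_j$ and $$c_{n\perp m,l,\dots,k,j}=c_{n\perp l,\dots,k,j}-\frac{B(c_{n\perp l,\dots,k,j},c_{m\perp l,\dots,k,j})}{Q(c_{m\perp l,\dots,k,j})}\,c_{m\perp l,\dots,k,j}.$$ Thus $c_{n\perp m,l,\dots,k,j}$ is the component of $c_n$ orthogonal to $\mathrm{Span}(c_m,c_l,\dots,c_k,c_j)$. Set $$v_j=\frac{B(c_j,x)}{\sqrt{Q(c_j)}},\qquad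 v_{j,k,\dots,l,m,n}=\frac{B(c_{n\perp m,l,\dots,k,j},x)}{\sqrt{Q(c_{n\perp m,l,\dots,k,j})}}.$$ Iterated integral $m_P$. For $u_1,\dots,u_P\in\mathbb{R}\setminus\{0\}$, $$m_P(u_1,\dots,u_P)=\Big(\prod_{j=1}^P(-u_j)\Big)\int_1^\infty d\omega_1\int_{\omega_1}^\infty d\omega_2\cdots\int_{\omega_{P-1}}^\infty d\omega_P\;\frac{e^{-\pi\sum_{l=1}^P\omega_lu_l^2}}{\sqrt{\prod_{k=1}^P\omega_k}}.$$ Equivalently, for any $\tau\in\mathbb{H}$ with $\tau_2=\mathrm{Im}(\tau)$ and $q^s=e^{2\pi i\tau s}$, the substitution $w_l=2i\tau_2\omega_l-\tau$ gives $$m_P(u_1,\dots,u_P)=\Big(\frac{i}{\sqrt{2\tau_2}}\Big)^P\prod_{j=1}^P\big(u_j\,q^{u_j^2/4\tau_2}\big)\int_{-\bar\tau}^{i\infty}dw_1\int_{w_1}^{i\infty}dw_2\cdots\int_{w_{P-1}}^{i\infty}dw_P\;\frac{e^{i\pi\sum_{l=1}^Pw_lu_l^2/2\tau_2}}{\sqrt{\prod_{k=1}^P(-i(w_k+\tau))}},$$ which is independent of $\tau$. *)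

(* Defs.v *)
From HB Require Import structures.
From mathcomp Require Import all_boot all_order all_algebra perm.
From mathcomp Require Import complex.
From mathcomp Require Import all_classical all_reals all_analysis.

Set Implicit Arguments.
Unset Strict Implicit.
Unset Printing Implicit Defensive.

Import Order.TTheory GRing.Theory Num.Theory.
Import numFieldNormedType.Exports.

Local Open Scope classical_set_scope.
Local Open Scope ring_scope.

(* A Z-basis of the lattice identifies Lambda (x) R with 'rV[R]_N, where B is
   given by the Gram matrix G of the lattice; the same formula over R[i], with
   the entries of G cast to R[i], is the complex-bilinear extension of B. *)
Definition bform (K : pzRingType) (N : nat) (G : 'M[K]_N) (u v : 'rV[K]_N) : K :=
  (u *m G *m v^T) 0 0.

Definition qform (K : pzRingType) (N : nat) (G : 'M[K]_N) (u : 'rV[K]_N) : K :=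
  bform G u u.

Definition posdef_gram (R : realType) (N : nat) (G : 'M[R]_N) : Prop :=
  G^T = G /\ forall u : 'rV[R]_N, u != 0 -> 0 < qform G u.

(* A family c_1, ..., c_P of vectors is the matrix c whose rows they are. *)
Definition fam_gram (R : realType) (N P : nat) (G : 'M[R]_N)
    (c : 'M[R]_(P, N)) : 'M[R]_P :=
  \matrix_(i, j) bform G (row i c) (row j c).

(* For independent c, the rows are the dual vectors c_l^* (dual_famP below). *)
Definition dual_fam (R : realType) (N P : nat) (G : 'M[R]_N)
    (c : 'M[R]_(P, N)) : 'M[R]_(P, N) :=
  invmx (fam_gram G c) *m c.

(* x^{||} = \sum_l B(c_l^*, x) c_l (proj_spanP below). *)
Definition proj_span (R : realType) (N P : nat) (G : 'M[R]_N)
    (c : 'M[R]_(P, N)) (x : 'rV[R]_N) : 'rV[R]_N :=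
  \sum_l bform G (row l (dual_fam G c)) x *: row l c.

(* e is a B-orthonormal basis of the span of c. *)
Definition orthonormal_basis (R : realType) (N P : nat) (G : 'M[R]_N)
    (c e : 'M[R]_(P, N)) : Prop :=
  (forall i j, bform G (row i e) (row j e) = (i == j)%:R) /\ (e == c)%MS.

Lemma bform_rows (K : pzRingType) (N m n : nat) (G : 'M[K]_N)
    (a : 'M[K]_(m, N)) (b : 'M[K]_(n, N)) i j :
  bform G (row i a) (row j b) = (a *m G *m b^T) i j.
Proof. by rewrite /bform -row_mul !mxE; apply: eq_bigr => k _; rewrite !mxE. Qed.

Lemma fam_gramE (R : realType) (N P : nat) (G : 'M[R]_N) (c : 'M[R]_(P, N)) :
  fam_gram G c = c *m G *m c^T.
Proof. by apply/matrixP => i j; rewrite mxE bform_rows. Qed.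

Lemma fam_gram_unit (R : realType) (N P : nat) (G : 'M[R]_N)
    (c : 'M[R]_(P, N)) :
  posdef_gram G -> row_free c -> fam_gram G c \in unitmx.
Proof.
move=> [_ Gpos] cfree; rewrite -row_free_unit -kermx_eq0.
apply/rowV0P => v /sub_kermxP; rewrite fam_gramE => vG0.
have [vc0|/Gpos] := eqVneq (v *m c) 0.
  by apply: (row_free_inj cfree); rewrite vc0 mul0mx.
by rewrite /qform /bform trmx_mul mulmxA -2!(mulmxA v) vG0 mul0mx mxE ltxx.
Qed.

Lemma dual_famP (R : realType) (N P : nat) (G : 'M[R]_N) (c : 'M[R]_(P, N)) :
  posdef_gram G -> row_free c ->
  (dual_fam G c <= c)%MS /\
  forall i j, bform G (row i c) (row j (dual_fam G c)) = (i == j)%:R.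
Proof.
move=> Gpd cfree; split=> [|i j]; first exact: submxMl.
have [Gsym _] := Gpd.
rewrite bform_rows /dual_fam trmx_mul trmx_inv mulmxA -fam_gramE.
have -> : (fam_gram G c)^T = fam_gram G c.
  by rewrite fam_gramE !trmx_mul trmxK Gsym mulmxA.
by rewrite mulmxV ?fam_gram_unit// mxE.
Qed.

Lemma proj_spanP (R : realType) (N P : nat) (G : 'M[R]_N) (c : 'M[R]_(P, N))
    (x : 'rV[R]_N) :
  posdef_gram G -> row_free c ->
  (proj_span G c x <= c)%MS /\
  forall i, bform G (row i c) (x - proj_span G c x) = 0.
Proof.
move=> Gpd cfree.
have -> : proj_span G c x = (dual_fam G c *m G *m x^T)^T *m c.
  rewrite mulmx_sum_row; apply: eq_bigr => l _; congr (_ *: _).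
  by rewrite mxE -bform_rows row_id.
split=> [|i]; first exact: submxMl.
set y := x - _.
rewrite -[y](row_id 0) bform_rows /y linearB /= trmx_mul trmxK mulmxBr.
rewrite /dual_fam !mulmxA -fam_gramE mulmxV ?fam_gram_unit// mul1mx.
by rewrite subrr mxE.
Qed.

(* Statements quantified over all orthonormal bases are not vacuous. *)
Lemma orthonormal_basis_exists (R : realType) (N P : nat) (G : 'M[R]_N)
    (c : 'M[R]_(P, N)) :
  posdef_gram G -> row_free c -> exists e, orthonormal_basis G c e.
Proof.
move=> [Gsym Gpos] cfree.
suff [e [eG ec]] : exists e : 'M[R]_(P, N), e *m G *m e^T = 1%:M /\ (e == c)%MS.
  by exists e; split=> // i j; rewrite bform_rows eG mxE.
elim: P => [|P IH] in c cfree *; first by exists c; rewrite submx_refl [LHS]flatmx0 [RHS]flatmx0.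
have [c0 [c1 cE]] : exists (c0 : 'rV[R]_N) (c1 : 'M[R]_(P, N)), c = col_mx c0 c1.
  by exists (@usubmx _ 1 P N c), (@dsubmx _ 1 P N c); rewrite vsubmxK.
have inj (a : 'M[R]_1) (v : 'rV[R]_P) : a *m c0 + v *m c1 = 0 -> a = 0 /\ v = 0.
  rewrite -mul_row_col -cE => av0; apply: eq_row_mx.
  by rewrite row_mx0; apply: (row_free_inj cfree); rewrite av0 mul0mx.
have [|e1 [e1G /eqmxP e1c]] := IH c1.
  rewrite -kermx_eq0; apply/rowV0P => v /sub_kermxP vc0.
  by have [|] := inj 0 v; rewrite ?vc0 ?mul0mx ?addr0.
pose A := c0 *m G *m e1^T.
pose w := c0 - A *m e1.
have we1 : w *m G *m e1^T = 0.
  rewrite /w !mulmxBl -(mulmxA A) -(mulmxA A) e1G mulmx1.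
  exact: subrr.
have e1w : e1 *m G *m w^T = 0.
  by apply: trmx_inj; rewrite !trmx_mul trmxK Gsym mulmxA we1 trmx0.
have w0 : w != 0.
  apply/eqP => w0; have /submxP[K e1K] : (e1 <= c1)%MS by rewrite e1c.
  have [|/matrixP/(_ 0 0)/eqP] := inj 1%:M (- (A *m K)).
    by rewrite mul1mx mulNmx -mulmxA -e1K.
  by rewrite !mxE oner_eq0.
have Qw := Gpos _ w0.
pose k := (Num.sqrt (qform G w))^-1.
have k0 : k != 0 by rewrite invr_eq0 sqrtr_eq0 -ltNge.
suff [e [eG ec]] : exists e : 'M[R]_(1 + P, N),
    e *m G *m e^T = 1%:M /\ (e == col_mx c0 c1)%MS.
  by exists e; rewrite cE.
exists (col_mx (k *: w) e1); split.
  rewrite mul_col_mx tr_col_mx mul_col_row -!scalemxAl we1 scaler0.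
  rewrite linearZ/= -!scalemxAr e1w scaler0 e1G (scalar_mx_block 1 P).
  congr (block_mx _ 0 0 1%:M); apply/matrixP => i j; rewrite !ord1.
  rewrite scalerA -expr2 /k exprVn [LHS]mxE -/(bform G w w) -/(qform G w).
  by rewrite sqr_sqrtr ?ltW// mulVf ?mxE// gt_eqF.
apply/eqmxP.
apply: (eqmx_trans (eqmx_sym (addsmxE _ _))).
apply: (eqmx_trans _ (addsmxE _ _)).
apply: (eqmx_trans (adds_eqmx (eqmx_scale _ k0) e1c)).
apply/eqmxP/andP; split; rewrite addsmx_sub addsmxSr andbT.
  rewrite /w addmx_sub ?addsmxSl// -mulNmx (submx_trans (submxMl _ _))// e1c.
  exact: addsmxSr.
rewrite (_ : c0 = w + A *m e1); last by rewrite /w subrK.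
by rewrite addmx_sub ?addsmxSl// (submx_trans (submxMl _ _))// e1c addsmxSr.
Qed.

Definition cexp (R : realType) (z : R[i]) : R[i] :=
  Complex (expR (complex.Re z) * cos (complex.Im z)) (expR (complex.Re z) * sin (complex.Im z)).

Definition Cintegral d (T : measurableType d) (R : realType)
    (mu : {measure set T -> \bar R}) (f : T -> R[i]) : R[i] :=
  Complex (\int[mu]_t complex.Re (f t)) (\int[mu]_t complex.Im (f t)).

Definition tcons (T : Type) (n : nat) (p : T * n.-tuple T) : n.+1.-tuple T :=
  [tuple of p.1 :: p.2].

Lemma measurable_tcons d (T : measurableType d) (n : nat) :
  measurable_fun [set: T * n.-tuple T] (@tcons T n).
Proof. exact: measurable_cons. Qed.

Definition cons_measure (R : realType) d (T : measurableType d) (n : nat)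
    (m1 : {sigma_finite_measure set T -> \bar R})
    (m2 : {sigma_finite_measure set (n.-tuple T) -> \bar R}) :
    set (n.+1.-tuple T) -> \bar R :=
  pushforward (m1 \x m2)%E (@tcons T n).

Lemma cons_measure0 (R : realType) d (T : measurableType d) (n : nat)
    (m1 : {sigma_finite_measure set T -> \bar R})
    (m2 : {sigma_finite_measure set (n.-tuple T) -> \bar R}) :
  cons_measure m1 m2 set0 = 0%E.
Proof. by rewrite /cons_measure /pushforward preimage_set0 measure0. Qed.

Lemma cons_measure_ge0 (R : realType) d (T : measurableType d) (n : nat)
    (m1 : {sigma_finite_measure set T -> \bar R})
    (m2 : {sigma_finite_measure set (n.-tuple T) -> \bar R}) A :
  (0 <= cons_measure m1 m2 A)%E.
Proof. exact: (measure_ge0 (m1 \x m2)%E). Qed.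

Lemma cons_measure_sigma_additive (R : realType) d (T : measurableType d)
    (n : nat) (m1 : {sigma_finite_measure set T -> \bar R})
    (m2 : {sigma_finite_measure set (n.-tuple T) -> \bar R}) :
  semi_sigma_additive (cons_measure m1 m2).
Proof.
have mtc := @measurable_tcons d T n.
move=> F mF tF mUF; rewrite /cons_measure /pushforward preimage_bigcup.
apply: measure_semi_sigma_additive.
- by move=> k; rewrite -[X in measurable X]setTI; exact: mtc.
- apply/trivIsetP => /= i j _ _ ij; rewrite -preimage_setI.
  by move/trivIsetP : tF => /(_ _ _ _ _ ij) ->//; rewrite preimage_set0.
- by rewrite -preimage_bigcup -[X in measurable X]setTI; exact: mtc.
Qed.

HB.instance Definition _ (R : realType) d (T : measurableType d) (n : nat)
    (m1 : {sigma_finite_measure set T -> \bar R})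
    (m2 : {sigma_finite_measure set (n.-tuple T) -> \bar R}) :=
  isMeasure.Build _ _ _ (cons_measure m1 m2) (cons_measure0 m1 m2)
    (cons_measure_ge0 m1 m2) (@cons_measure_sigma_additive R d T n m1 m2).

Lemma cons_measure_sigma_finite (R : realType) d (T : measurableType d)
    (n : nat) (m1 : {sigma_finite_measure set T -> \bar R})
    (m2 : {sigma_finite_measure set (n.-tuple T) -> \bar R}) :
  sigma_finite setT (cons_measure m1 m2).
Proof.
have /sigma_finiteP[F [TF ndF Foo]] := sigma_finiteT m1.
have /sigma_finiteP[G [TG ndG Goo]] := sigma_finiteT m2.
pose g (t : n.+1.-tuple T) := (thead t, [tuple of behead t]).
have tK : cancel (@tcons T n) g.
  by move=> [a t]; congr pair; exact/val_inj.
have mg : measurable_fun [set: n.+1.-tuple T] g.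
  apply: measurable_fun_pair; first exact: measurable_tnth.
  exact: measurable_behead.
exists (fun k => g @^-1` (F k `*` G k)).
  apply/seteqP; split=> // t _.
  have [k _ Fk] : (\bigcup_k F k) (thead t) by rewrite -TF.
  have [l _ Gl] : (\bigcup_k G k) [tuple of behead t] by rewrite -TG.
  exists (maxn k l) => //; split=> /=.
  - by move: (thead t) Fk; exact/subsetPset/ndF/leq_maxl.
  - by move: [tuple of behead t] Gl; exact/subsetPset/ndG/leq_maxr.
move=> k; have [mF Fk] := Foo k; have [mG Gk] := Goo k.
have mFG : measurable (F k `*` G k) by exact: measurableX.
split; first by rewrite -[X in measurable X]setTI; exact: mg.
rewrite /cons_measure /pushforward (_ : _ @^-1` _ = F k `*` G k).
  by rewrite product_measure1E// lte_mul_pinfty// ge0_fin_numE.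
by apply/seteqP; split=> p; rewrite /preimage /mkset tK.
Qed.

HB.instance Definition _ (R : realType) d (T : measurableType d) (n : nat)
    (m1 : {sigma_finite_measure set T -> \bar R})
    (m2 : {sigma_finite_measure set (n.-tuple T) -> \bar R}) :=
  Measure_isSigmaFinite.Build _ _ _ (cons_measure m1 m2)
    (cons_measure_sigma_finite m1 m2).

(* The n-fold product of m, on n-tuples. *)
Fixpoint power_measure (R : realType) d (T : measurableType d) (n : nat)
    (m : {sigma_finite_measure set T -> \bar R}) :
    {sigma_finite_measure set (n.-tuple T) -> \bar R} :=
  match n with
  | 0 => \d_ ([tuple] : 0.-tuple T)
  | n'.+1 => cons_measure m (power_measure n' m)
  end.

Definition lebesgue_tuple (R : realType) (n : nat) :
    {sigma_finite_measure set (n.-tuple (measurableTypeR R)) -> \bar R} :=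
  power_measure n (@lebesgue_measure R).

Definition cplx_mx (R : realType) (m n : nat) (A : 'M[R]_(m, n)) :
    'M[R[i]]_(m, n) :=
  map_mx (real_complex R) A.

(* y = \sum_l t_l e_l - i x^{||}, which runs over <c_1, ..., c_P> - i x^{||}. *)
Definition contour (R : realType) (N P : nat) (G : 'M[R]_N)
    (c e : 'M[R]_(P, N)) (x : 'rV[R]_N)
    (t : P.-tuple (measurableTypeR R)) : 'rV[R[i]]_N :=
  cplx_mx (\sum_l (tnth t l : R) *: row l e)
  - ('i%C : R[i]) *: cplx_mx (proj_span G c x).

(* M_P({c_l}, x; Lambda), with d^P y written in the coordinates of an
   orthonormal basis e of <c_1, ..., c_P>; the value does not depend on e. *)
Definition gen_erfc (R : realType) (N P : nat) (G : 'M[R]_N)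
    (c e : 'M[R]_(P, N)) (x : 'rV[R]_N) : R[i] :=
  let B := bform (cplx_mx G) in
  let Q := qform (cplx_mx G) in
  let cstar l := cplx_mx (row l (dual_fam G c)) in
  let pic : R[i] := (pi : R)%:C%C in
  (Num.sqrt (\det (fam_gram G (dual_fam G c))))%:C%C * ('i%C / pic) ^+ P *
  Cintegral (lebesgue_tuple R P) (fun t =>
    let y := contour G c e x t in
    (\prod_l (B (cstar l) y)^-1) *
    cexp (- pic * Q y - 2 * pic * 'i%C * B y (cplx_mx x))).

(* cperp G c [:: m; l; ...; k; j] n is c_{n \perp m, l, ..., k, j}. *)
Fixpoint cperp (R : realType) (N P : nat) (G : 'M[R]_N) (c : 'M[R]_(P, N))
    (s : seq 'I_P) (n : 'I_P) : 'rV[R]_N :=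
  match s with
  | [::] => row n c
  | m :: s' =>
      cperp G c s' n
      - (bform G (cperp G c s' n) (cperp G c s' m) / qform G (cperp G c s' m))
        *: cperp G c s' m
  end.

(* v_{j, k, ..., l, m, n} is vvar G c x [:: j; k; ...; l; m; n]: the indices to
   project out are listed in the opposite order in c_{n \perp m, l, ..., k, j}.
   The value on the empty sequence is irrelevant. *)
Definition vvar (R : realType) (N P : nat) (G : 'M[R]_N) (c : 'M[R]_(P, N))
    (x : 'rV[R]_N) (s : seq 'I_P) : R :=
  match rev s with
  | [::] => 0
  | n :: s' => bform G (cperp G c s' n) x / Num.sqrt (qform G (cperp G c s' n))
  end.

(* \int_a^oo dw_1 \int_{w_1}^oo dw_2 ... \int_{w_{n-1}}^oo dw_n
     F [:: w_1; ...; w_n] *)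
Fixpoint iter_integral (R : realType) (n : nat) (a : R) (F : seq R -> R) : R :=
  match n with
  | 0 => F [::]
  | n'.+1 => \int[@lebesgue_measure R]_(w in `[a, +oo[)
               iter_integral n' w (fun ws => F (w :: ws))
  end.

Definition iter_m (R : realType) (P : nat) (u : 'I_P -> R) : R :=
  (\prod_j (- u j)) *
  iter_integral P 1 (fun w =>
    expR (- pi * \sum_(l < P) w`_l * u l ^+ 2) /
    Num.sqrt (\prod_(k < P) w`_k)).

(* Main.v *)
Require Import Defs.
From HB Require Import structures.
From mathcomp Require Import all_boot all_order all_algebra perm.
From mathcomp Require Import complex.
From mathcomp Require Import all_classical all_reals all_analysis.
From mathcomp Require Import measurable_realfun.
From mathcomp Require Import ring lra.

Set Implicit Arguments.
Unset Strict Implicit.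
Unset Printing Implicit Defensive.

Import Order.TTheory GRing.Theory Num.Theory.
Import numFieldNormedType.Exports.

Local Open Scope classical_set_scope.
Local Open Scope ring_scope.

(** On the contour the exponent is real. With y = t - i x' for t in the span of
    the c_l and x' the projection of x, the linear terms in t cancel and the
    Gaussian factor is e^(- pi Q(t) - pi Q(x')), while the denominators become
    a_l(t) - i b_l with a_l(t) = B(d_l, t) and b_l = B(d_l, x), where d_l is the
    dual vector of c_l. The b_l do not vanish, because d_l is proportional to
    the component of c_l orthogonal to all the other c_k (dual_bform_neq0).

    The first step makes the integral real. Each 1 / (a_l - i b_l) is, up to
    the factor i eps_l with eps_l = sgn b_l, the Laplace integral of
    2 pi e^(- 2 pi (|b_l| + i eps_l a_l) r) over r >= 0. After Fubini the
    integral over t is the Fourier transform of a Gaussian, and the exponents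
    add up to a square (gen_erfc_orthant_mass):

      M_P(x) = (prod_l (- 2 eps_l)) sqrt(det (B(d_j, d_k)))
               * int_(r >= 0) e^(- pi Q(x' + sum_l eps_l r_l d_l)) dr,

    that is, M_P is a signed Gaussian mass of the cone with apex x' and edges
    eps_l d_l.

    The second step moves the apex. The mass of the cone with apex (sqrt w) x'
    tends to 0 as w grows, and its derivative in w is a flux through the faces
    of the cone: x' is the combination of the edges with coefficients
    eps_l B(c_l, x), and the derivative of the Gaussian along an edge
    integrates to the mass of the face without that edge (cone_recursion). That
    face is orthogonal to c_l, so its mass is e^(- pi w v_l^2) times the mass
    of a cone of dimension P - 1, spanned by the dual family of the c_k
    projected away from c_l (cone_int_perp, biorthogonal_perp_fam). The
    prefactors match as det (B(d_j, d_k)) Q(c_l) is the Gram determinant of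
    the remaining d_k (det_fam_gram_row'). Hence

      M_P((sqrt a) x) = sum_l (- v_l) int_a^oo e^(- pi w v_l^2) / (sqrt w)
                                      * M_(P - 1)((sqrt w) x) dw,

    where M_(P - 1) belongs to the projected family. Iterating this over the
    choice of the first index, then of the second, and so on, produces one
    nested integral for each ordering of the indices
    (orthant_mass_flag_sum). The case a = 1 is the theorem. *)

(** * Powers of Lebesgue measure on the half-line *)

Section half_line.
Context {R : realType}.
Local Notation mu := (@lebesgue_measure R : {measure set (measurableTypeR R) ->
    \bar R}).

(** The powers of this measure are Lebesgue measure on the positive orthants,
    so that integrals over an orthant range over all tuples and Fubini's
    theorem applies to them without any bookkeeping of domains. *)
Definition half_lebesgue : set (measurableTypeR R) -> \bar R :=
  mrestr (@lebesgue_measure R) (measurable_itv `[0, +oo[).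

HB.instance Definition _ := Measure.on half_lebesgue.

Lemma half_lebesgue_sigma_finite : sigma_finite setT half_lebesgue.
Proof.
have [F UF mF] := sigma_finiteT (@lebesgue_measure R).
exists F => // k; have [mFk Fk] := mF k; split=> //.
apply: le_lt_trans Fk; apply: le_measure; rewrite ?inE//.
exact: measurableI.
Qed.

HB.instance Definition _ :=
  Measure_isSigmaFinite.Build _ _ _ half_lebesgue half_lebesgue_sigma_finite.

Lemma integral_half_lebesgue (f : measurableTypeR R -> \bar R) : measurable_fun
    [set: measurableTypeR R] f ->
  (\int[half_lebesgue]_x f x = \int[mu]_(x in `[0%R, +oo[) f x)%E.
Proof.
have ge0 (g : measurableTypeR R -> \bar R) : measurable_fun [set:
    measurableTypeR R] g -> (forall x, 0 <= g x)%E ->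
  (\int[half_lebesgue]_x g x = \int[mu]_(x in `[0%R, +oo[) g x)%E.
  move=> mg g0.
  rewrite (@ge0_negligible_integral _ _ _ half_lebesgue setT (~` `[0%R, +oo[))//.
  - rewrite setTD setCK; apply: eq_measure_integral => A mA AD.
    by rewrite /= /half_lebesgue /mrestr setIidl.
  - exact: measurableC.
  - by rewrite /= /half_lebesgue /mrestr setICl measure0.
move=> mf; rewrite [LHS]integralE [RHS]integralE.
by rewrite !ge0//; [exact: measurable_funeneg|exact: measurable_funepos].
Qed.

End half_line.

Section power_measure.
Context d (T : measurableType d) (R : realType).
Variable m : {sigma_finite_measure set T -> \bar R}.
Local Notation pow n := (power_measure n m).

Lemma integral_power0 (f : 0.-tuple T -> \bar R) : measurable_fun setT f ->
  (\int[pow 0]_t f t = f [tuple])%E.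
Proof. by move=> mf; rewrite integral_dirac// diracT mul1e. Qed.

(** The integral of f is the difference of those of its positive and negative
    parts, and both parts commute with the composition with h. *)
Lemma integral_measurable_comp n d2 (T2 : measurableType d2)
    (m2 : {measure set T2 -> \bar R}) (h : T2 -> n.-tuple T) :
  measurable_fun setT h ->
  (forall f : n.-tuple T -> \bar R, measurable_fun setT f ->
    (forall t, 0 <= f t)%E ->
    (\int[pow n]_t f t = \int[m2]_p f (h p))%E) ->
  forall f : n.-tuple T -> \bar R, measurable_fun setT f ->
    (\int[pow n]_t f t = \int[m2]_p f (h p))%E.
Proof.
move=> mh ge0 f mf; rewrite [LHS]integralE [RHS]integralE.
rewrite !ge0//; [|exact: measurable_funeneg|exact: measurable_funepos].
by congr (_ - _)%E; apply: eq_integral => p _; rewrite ?funeposE ?funenegE.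
Qed.

Lemma ge0_integral_power_cons n (f : n.+1.-tuple T -> \bar R) :
  measurable_fun setT f -> (forall t, 0 <= f t)%E ->
  (\int[pow n.+1]_t f t = \int[m \x pow n]_p f (tcons p))%E.
Proof.
move=> mf f0.
rewrite /= /cons_measure ge0_integral_pushforward//.
exact: measurable_tcons.
Qed.

Lemma integral_power_cons n (f : n.+1.-tuple T -> \bar R) :
  measurable_fun setT f ->
  (\int[pow n.+1]_t f t = \int[m \x pow n]_p f (tcons p))%E.
Proof.
apply: integral_measurable_comp; first exact: measurable_tcons.
exact: ge0_integral_power_cons.
Qed.

(** The edge that leads from a cone to one of its faces is not always the
    first one, hence the insertion of a coordinate at any position. *)
Definition tins n (l : 'I_n.+1) (p : T * n.-tuple T) : n.+1.-tuple T :=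
  [tuple if unlift l k is Some j then tnth p.2 j else p.1 | k < n.+1].

Lemma tnth_tins_eq n (l : 'I_n.+1) p : tnth (tins l p) l = p.1.
Proof. by rewrite tnth_mktuple unlift_none. Qed.

Lemma tnth_tins_lift n (l : 'I_n.+1) p j : tnth (tins l p) (lift l j) = tnth p.2 j.
Proof. by rewrite tnth_mktuple liftK. Qed.

Lemma measurable_tins n (l : 'I_n.+1) : measurable_fun setT (@tins n l).
Proof.
apply/measurable_fun_tnthP => i.
have [j ->|->] := unliftP l i.
  rewrite (_ : _ \o _ = (@tnth _ T ^~ j) \o snd).
    by apply: measurableT_comp => //; exact: measurable_tnth.
  by apply/funext => p /=; rewrite tnth_tins_lift.
rewrite (_ : _ \o _ = fst)//.
by apply/funext => p /=; rewrite tnth_tins_eq.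
Qed.

Lemma tins0 n p : @tins n ord0 p = tcons p.
Proof.
apply: eq_from_tnth => i; have [j ->|->] := unliftP ord0 i.
  by rewrite tnth_tins_lift tnthS.
by rewrite tnth_tins_eq tnth0.
Qed.

Lemma tins_lift n (l : 'I_n.+1) a b (t : n.-tuple T) :
  tins (lift ord0 l) (a, tcons (b, t)) = tcons (b, tins l (a, t)).
Proof.
apply: eq_from_tnth => i; have [j ->|->] := unliftP ord0 i; last first.
  rewrite tnth0 /=.
  have -> : (ord0 : 'I_n.+2) = lift (lift ord0 l) ord0 by apply: val_inj.
  by rewrite tnth_tins_lift tnth0.
rewrite [RHS]tnthS; have [j' ->|->] := unliftP l j.
  rewrite [RHS]tnth_tins_lift.
  have -> : lift ord0 (lift l j') = lift (lift ord0 l) (lift ord0 j').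
    by apply: val_inj; rewrite /= /bump/= !add1n ltnS addnS.
  by rewrite tnth_tins_lift tnthS.
by rewrite [RHS]tnth_tins_eq tnth_tins_eq.
Qed.

(** Induction on the position: past the head, Tonelli's theorem exchanges the
    integrations over the head and over the inserted coordinate. *)
Lemma ge0_integral_power_ins n (l : 'I_n.+1) (f : n.+1.-tuple T -> \bar R) :
  measurable_fun setT f -> (forall t, 0 <= f t)%E ->
  (\int[pow n.+1]_t f t = \int[m \x pow n]_p f (tins l p))%E.
Proof.
elim: n => [|n IH] in l f *.
  by rewrite (ord1 l) => mf f0; rewrite ge0_integral_power_cons//;
    apply: eq_integral => p _; rewrite tins0.
have [l' ->|->] := unliftP ord0 l; last first.
  by move=> mf f0; rewrite ge0_integral_power_cons//;
    apply: eq_integral => p _; rewrite tins0.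
move=> mf f0.
have mft l0 : measurable_fun setT (fun p => f (tins l0 p)).
  by apply: measurableT_comp => //; exact: measurable_tins.
rewrite ge0_integral_power_cons// fubini_tonelli1//; last first.
  by apply: measurableT_comp => //; exact: measurable_tcons.
rewrite [RHS]fubini_tonelli1//.
have mtc b : measurable_fun setT (fun t : n.+1.-tuple T => tcons (b, t)).
  by apply: measurable_cons; [exact: measurable_cst|exact: measurable_id].
pose F (q : T * T) := (\int[pow n]_t f (tcons (q.1, tins l' (q.2, t))))%E.
have mF : measurable_fun setT F.
  apply: (@measurable_fun_fubini_tonelli_F _ _ _ _ _ (pow n)
    (fun r : (T * T) * n.-tuple T => f (tcons (r.1.1, tins l' (r.1.2, r.2))))).
    apply: measurableT_comp => //.
    apply: measurable_cons; first exact: (measurableT_comp measurable_fst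
        measurable_fst).
    apply: (measurableT_comp (measurable_tins l')).
    apply: measurable_fun_pair; last exact: measurable_snd.
    exact: (measurableT_comp measurable_snd measurable_fst).
  by [].
transitivity (\int[m]_b \int[m]_a F (b, a))%E.
  apply: eq_integral => b _; rewrite /fubini_F (IH l')//; last first.
    by apply: measurableT_comp => //; exact: mtc.
  rewrite fubini_tonelli1//.
  apply: (measurableT_comp (measurableT_comp mf (mtc b))).
  exact: measurable_tins.
rewrite (sfinite_Fubini m m F)//; last by move=> q; exact: integral_ge0.
apply: eq_integral => a _; rewrite /fubini_F.
rewrite ge0_integral_power_cons//; last first.
  apply: (measurableT_comp (mft (lift ord0 l'))).
  by apply: measurable_fun_pair; [exact: measurable_cst|exact: measurable_id].
rewrite fubini_tonelli1//; last first.
  apply: (measurableT_comp (mft (lift ord0 l'))).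
  by apply: measurable_fun_pair; [exact: measurable_cst|exact: measurable_tcons].
apply: eq_integral => b _; rewrite /F /fubini_F.
by apply: eq_integral => t _; rewrite tins_lift.
Qed.

Lemma integral_power_ins n (l : 'I_n.+1) (f : n.+1.-tuple T -> \bar R) :
  measurable_fun setT f ->
  (\int[pow n.+1]_t f t = \int[m \x pow n]_p f (tins l p))%E.
Proof.
apply: integral_measurable_comp; first exact: measurable_tins.
exact: ge0_integral_power_ins.
Qed.

Lemma integrable_power_ins n (l : 'I_n.+1) (f : n.+1.-tuple T -> \bar R) :
  (pow n.+1).-integrable setT f ->
  (m \x pow n)%E.-integrable setT (fun p => f (tins l p)).
Proof.
move=> /integrableP[mf foo]; apply/integrableP; split.
  by apply: (measurableT_comp mf); exact: measurable_tins.
rewrite -(@integral_power_ins n l (fun t => `|f t|)%E)//.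
exact: measurableT_comp.
Qed.

End power_measure.

(** * Trigonometric integrals against product weights *)

Section trigonometric_functions.
Context {R : realType}.
Implicit Types (p q x : R).

Lemma measurable_cos : measurable_fun [set: R] (@cos R).
Proof. by apply: continuous_measurable_fun; exact: continuous_cos. Qed.

Lemma measurable_sin : measurable_fun [set: R] (@sin R).
Proof. by apply: continuous_measurable_fun; exact: continuous_sin. Qed.

Lemma normr_cos_le1 x : `|cos x| <= 1.
Proof. by rewrite ler_norml cos_geN1 cos_le1. Qed.

Lemma normr_sin_le1 x : `|sin x| <= 1.
Proof. by rewrite ler_norml sin_geN1 sin_le1. Qed.

Lemma normr_trig_le p q x : `|p * cos x + q * sin x| <= `|p| + `|q|.
Proof.
apply: (le_trans (ler_normD _ _)); rewrite !normrM lerD//.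
  by rewrite ler_piMr// normr_cos_le1.
by rewrite ler_piMr// normr_sin_le1.
Qed.

End trigonometric_functions.

Lemma dominated_integrable d (T : measurableType d) (R : realType)
    (mu : {measure set T -> \bar R}) (f g : T -> R) :
  measurable_fun setT f -> (forall x, `|f x| <= g x) ->
  mu.-integrable setT (EFin \o g) -> mu.-integrable setT (EFin \o f).
Proof.
move=> mf fg; apply: le_integrable => //; first exact/measurable_EFinP.
by move=> x _; rewrite /= lee_fin (le_trans (fg x))// ler_norm.
Qed.

Lemma integrable_integral d (T : measurableType d) (R : realType)
    (mu : {measure set T -> \bar R}) (f : T -> R) :
  mu.-integrable setT (EFin \o f) ->
  (\int[mu]_x (f x)%:E = (\int[mu]_x f x)%:E)%E.
Proof. by move=> fi; rewrite fineK// integrable_fin_num. Qed.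

Section real_integrals.
Context d (T : measurableType d) (R : realType) (mu : {measure set T -> \bar R}).
Variables (D : set T) (mD : measurable D).

Lemma integrable_scale (k : R) (f : T -> R) : mu.-integrable D (EFin \o f) ->
  mu.-integrable D (EFin \o (fun x => k * f x)).
Proof. by move=> /(integrableZl mD k); apply: eq_integrable. Qed.

Lemma integrable_bigsum (I : finType) (f : I -> T -> R) :
  (forall i, mu.-integrable D (EFin \o f i)) ->
  mu.-integrable D (EFin \o (fun x => \sum_i f i x)).
Proof.
move=> fi; have := integrable_sum mD (index_enum I) (P := xpredT) (fun i _ => fi i).
by apply: eq_integrable => // x _; rewrite /= sumEFin.
Qed.

Lemma Rintegral_bigsum (I : finType) (f : I -> T -> R) :
  (forall i, mu.-integrable D (EFin \o f i)) ->
  \int[mu]_(x in D) (\sum_i f i x) = \sum_i \int[mu]_(x in D) f i x.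
Proof.
move=> fi; apply: EFin_inj; rewrite fineK; last first.
  by apply: integrable_fin_num => //; exact: integrable_bigsum.
transitivity (\sum_i \int[mu]_(x in D) (f i x)%:E)%E.
  by rewrite -integral_sum//; apply: eq_integral => x _; rewrite sumEFin.
rewrite -sumEFin; apply: eq_bigr => i _; rewrite fineK//.
by apply: integrable_fin_num => //; exact: fi.
Qed.

End real_integrals.

Lemma integrable_tensor d1 d2 (T1 : measurableType d1) (T2 : measurableType d2)
    (R : realType) (m1 : {sigma_finite_measure set T1 -> \bar R})
    (m2 : {sigma_finite_measure set T2 -> \bar R}) (f1 : T1 -> R) (f2 : T2 -> R) :
  m1.-integrable setT (EFin \o f1) -> m2.-integrable setT (EFin \o f2) ->
  (m1 \x m2)%E.-integrable setT (EFin \o (fun p => f1 p.1 * f2 p.2)).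
Proof.
move=> i1 i2.
have m1f : measurable_fun setT f1 by exact/measurable_EFinP/(measurable_int _ i1).
have m2f : measurable_fun setT f2 by exact/measurable_EFinP/(measurable_int _ i2).
apply/integrable12ltyP.
  apply/measurable_EFinP; apply: measurable_funM.
    exact: (measurableT_comp m1f measurable_fst).
  exact: (measurableT_comp m2f measurable_snd).
have i2' : m2.-integrable setT (EFin \o (fun y => `|f2 y|)).
  by apply: eq_integrable (integrable_abse i2).
pose I := \int[m2]_y `|f2 y|.
rewrite (eq_integral (fun x => I%:E * `|(f1 x)%:E|)%E); last first.
  move=> x _; rewrite muleC /I -(integrable_integral i2') -(integralZl _ i2')//.
  by apply: eq_integral => y _; rewrite /= normrM EFinM.
have i1' := integrable_abse i1.
by apply: integrable_lty => //; apply: integrableZl.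
Qed.

Section power_trig.
Context d (T : measurableType d) (R : realType).
Variable m : {sigma_finite_measure set T -> \bar R}.
Local Notation pow n := (power_measure n m).

Lemma measurable_tnth_comp n (l : 'I_n) (f : T -> R) : measurable_fun setT f ->
  measurable_fun setT (fun t : n.-tuple T => f (tnth t l)).
Proof. by move=> mf; apply: (measurableT_comp mf); exact: measurable_tnth. Qed.

Lemma measurable_prod_tnth n (w : 'I_n -> T -> R) :
  (forall l, measurable_fun setT (w l)) ->
  measurable_fun setT (fun t : n.-tuple T => \prod_l w l (tnth t l)).
Proof.
by move=> mw; apply: measurable_prod => l _; exact: measurable_tnth_comp.
Qed.

Lemma integrable_prod_tnth n (w : 'I_n -> T -> R) :
  (forall l x, 0 <= w l x) ->
  (forall l, m.-integrable setT (EFin \o w l)) ->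
  (pow n).-integrable setT (fun t => (\prod_l w l (tnth t l))%:E).
Proof.
elim: n w => [|n IH] w w0 iw.
  apply/integrableP; split.
    apply/measurable_EFinP; apply: measurable_prod_tnth => -[//].
  rewrite integral_power0; last first.
    do 2 apply: measurableT_comp => //.
    by apply: measurable_prod_tnth => -[].
  by rewrite big_ord0 ltry.
have mw l : measurable_fun setT (w l).
  exact/measurable_EFinP/(measurable_int _ (iw l)).
have mW : measurable_fun setT
    (fun t : n.+1.-tuple T => (\prod_l w l (tnth t l))%:E).
  by apply/measurable_EFinP; exact: measurable_prod_tnth.
apply/integrableP; split=> //.
have mW' : measurable_fun setT (fun t : n.+1.-tuple T =>
   `|(\prod_l w l (tnth t l))%:E|%E) by exact: measurableT_comp.
rewrite ge0_integral_power_cons// fubini_tonelli1//; last first.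
  by apply: (measurableT_comp mW'); exact: measurable_tcons.
have iw' := IH (fun l => w (lift ord0 l)) (fun l => w0 _) (fun l => iw _).
pose I := (\int[pow n]_t \prod_l w (lift ord0 l) (tnth t l)).
rewrite (_ : (fun _ => _) = (fun x => (I%:E * (w ord0 x)%:E)%E)).
  by apply: integrable_lty => //; apply: integrableZl => //; exact: iw.
apply/funext => a; rewrite /fubini_F muleC.
rewrite /I -integrable_integral// -ge0_integralZl//; last 3 first.
- exact: measurable_int iw'.
- by move=> t _; rewrite lee_fin; apply: prodr_ge0.
- by rewrite lee_fin.
apply: eq_integral => t _; rewrite -EFinM /= ger0_norm; last exact: prodr_ge0.
rewrite big_ord_recl tnth0; congr (_ * _)%:E.
by apply: eq_bigr => i _; rewrite tnthS.
Qed.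

End power_trig.

(** With chi_l = C_l - i S_l, the integral of w_l e^(- i k_l), the right-hand
    side is Re((p + i q) prod_l chi_l). The Laplace and the Gaussian integrals
    below are both of this kind. The pair (p, q) has to be arbitrary for the
    induction: the addition formulas rotate it by the phase split off. *)
Lemma integral_prod_trig d (T : measurableType d) (R : realType)
    (m : {sigma_finite_measure set T -> \bar R})
    n (w k : 'I_n -> T -> R) (C S : 'I_n -> R) :
  (forall l x, 0 <= w l x) ->
  (forall l, m.-integrable setT (EFin \o w l)) ->
  (forall l, measurable_fun setT (k l)) ->
  (forall l, \int[m]_x (w l x * cos (k l x))%:E = (C l)%:E)%E ->
  (forall l, \int[m]_x (w l x * sin (k l x))%:E = (S l)%:E)%E ->
  forall p q : R,
  (\int[power_measure n m]_t
     ((\prod_l w l (tnth t l)) *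
      (p * cos (\sum_l k l (tnth t l)) + q * sin (\sum_l k l (tnth t l))))%:E =
   (complex.Re (Complex p q * \prod_l Complex (C l) (- S l)))%:E)%E.
Proof.
move=> w0 iw mk hC hS.
have mw l : measurable_fun setT (w l).
  exact/measurable_EFinP/(measurable_int _ (iw l)).
elim: n => [|n IH] in w k C S w0 iw mk hC hS mw * => p q.
  rewrite integral_power0; last first.
    apply/measurable_EFinP; apply: measurable_funM.
      by apply: measurable_prod_tnth => -[].
    by under eq_fun do rewrite big_ord0; exact: measurable_cst.
  by rewrite !big_ord0 cos0 sin0 /=; congr EFin; ring.
have mtrig (n' : nat) (k' : 'I_n' -> T -> R) p' q' : (forall l, measurable_fun
    setT (k' l)) ->
    measurable_fun setT (fun t : n'.-tuple T =>
      p' * cos (\sum_l k' l (tnth t l)) + q' * sin (\sum_l k' l (tnth t l))).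
  move=> mk'.
  have ms : measurable_fun setT (fun t : n'.-tuple T => \sum_l k' l (tnth t l)).
    by apply: measurable_sum => l; exact: measurable_tnth_comp.
  by apply: measurable_funD; apply: measurable_funM => //;
    [exact: (measurableT_comp measurable_cos)|exact: (measurableT_comp
        measurable_sin)].
have mf : measurable_fun setT (fun t : n.+1.-tuple T =>
   ((\prod_l w l (tnth t l)) *
      (p * cos (\sum_l k l (tnth t l)) + q * sin (\sum_l k l (tnth t l))))).
  by apply: measurable_funM; [exact: measurable_prod_tnth|exact: mtrig].
have /measurable_EFinP mfE := mf.
rewrite integral_power_cons//.
rewrite -integral12_prod_meas1; last first.
  have intf : (power_measure n.+1 m).-integrable setT (fun t : n.+1.-tuple T =>
     ((`|p| + `|q|) * (\prod_l w l (tnth t l)))%:E).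
    under eq_fun do rewrite EFinM.
    by apply: integrableZl => //; exact: integrable_prod_tnth.
  apply/integrableP; split.
    by apply: (measurableT_comp mfE); exact: measurable_tcons.
  have /integrableP[_] : (power_measure n.+1 m).-integrable setT (EFin \o
     (fun t : n.+1.-tuple T => (\prod_l w l (tnth t l)) *
      (p * cos (\sum_l k l (tnth t l)) + q * sin (\sum_l k l (tnth t l))))).
    apply: (dominated_integrable mf _ intf) => t.
    rewrite normrM ger0_norm ?prodr_ge0// mulrC.
    by rewrite ler_wpM2r ?prodr_ge0 ?normr_trig_le.
  rewrite integral_power_cons//.
  by apply: measurableT_comp => //; exact/measurable_EFinP.
set Pi := \prod_(l < n) Complex (C (lift ord0 l)) (- S (lift ord0 l)).
rewrite big_ord_recl /= -/Pi.
have -> : complex.Re (Complex p q * (Complex (C ord0) (- S ord0) * Pi)) =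
  (p * complex.Re Pi - q * complex.Im Pi) * C ord0 +
  (q * complex.Re Pi + p * complex.Im Pi) * S ord0.
  by case: Pi => u v /=; ring.
have iwt (h : R -> R) : measurable_fun setT h -> (forall x, `|h x| <= 1) ->
    m.-integrable setT (fun x => (w ord0 x * h (k ord0 x))%:E).
  move=> mh h1; apply: (dominated_integrable _ _ (iw ord0)).
    by apply: measurable_funM => //; exact: measurableT_comp.
  by move=> x; rewrite normrM ger0_norm// ler_piMr.
have icos := iwt _ measurable_cos normr_cos_le1.
have isin := iwt _ measurable_sin normr_sin_le1.
rewrite EFinD !EFinM -hC -hS -!integralZl// -integralD//; last 2 first.
- exact: integrableZl.
- exact: integrableZl.
apply: eq_integral => a _; rewrite /fubini_F.
set p' := p * cos (k ord0 a) + q * sin (k ord0 a).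
set q' := q * cos (k ord0 a) - p * sin (k ord0 a).
have := IH (fun l => w (lift ord0 l)) (fun l => k (lift ord0 l))
  (fun l => C (lift ord0 l)) (fun l => S (lift ord0 l)) (fun l => w0 _)
  (fun l => iw _) (fun l => mk _) (fun l => hC _) (fun l => hS _)
  (fun l => mw _) p' q'.
rewrite -/Pi => IH'.
transitivity (\int[power_measure n m]_t ((w ord0 a)%:E *
  ((\prod_l w (lift ord0 l) (tnth t l)) *
      (p' * cos (\sum_l k (lift ord0 l) (tnth t l)) +
       q' * sin (\sum_l k (lift ord0 l) (tnth t l))))%:E))%E.
  apply: eq_integral => t _; rewrite -EFinM.
  have hd (h : 'I_n.+1 -> T -> R) : \sum_l h l (tnth (tcons (a, t)) l) =
      h ord0 a + \sum_l h (lift ord0 l) (tnth t l).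
    rewrite big_ord_recl tnth0; congr (_ + _).
    by apply: eq_bigr => i _; rewrite tnthS.
  have hdp (h : 'I_n.+1 -> T -> R) : \prod_l h l (tnth (tcons (a, t)) l) =
      h ord0 a * \prod_l h (lift ord0 l) (tnth t l).
    rewrite big_ord_recl tnth0; congr (_ * _).
    by apply: eq_bigr => i _; rewrite tnthS.
  rewrite hd hdp.
  by rewrite cosD sinD /p' /q'; congr EFin; ring.
rewrite integralZl//; last first.
  apply: (@dominated_integrable _ _ _ _ _
     (fun t => (`|p'| + `|q'|) * (\prod_l w (lift ord0 l) (tnth t l)))).
  - apply: measurable_funM; last exact: (mtrig _ (fun l => k (lift ord0 l))).
    apply: (@measurable_prod_tnth _ _ _ _ (fun l => w (lift ord0 l))) => l.
    exact: mw.
  - move=> t; rewrite normrM ger0_norm ?prodr_ge0// mulrC.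
    by rewrite ler_wpM2r ?prodr_ge0 ?normr_trig_le.
  - rewrite /comp; under eq_fun do rewrite EFinM.
    apply: integrableZl => //.
    exact: (@integrable_prod_tnth _ _ _ _ _ (fun l => w (lift ord0 l))).
rewrite IH' -!EFinM -EFinD; congr EFin.
by rewrite /p' /q'; case: (Pi) => u v /=; ring.
Qed.

(** * Antiderivatives on the half-line *)

Section real_derivatives.
Context {R : realType}.
Implicit Types (f g : R -> R) (x a b k : R).

Lemma is_derive_mulf f g x a b : is_derive x 1 f a -> is_derive x 1 g b ->
  is_derive x 1 (fun y => f y * g y) (a * g x + f x * b).
Proof.
move=> df dg; rewrite [X in is_derive _ _ _ X](_ : _ = f x *: b + g x *: a).
  exact: (is_deriveM df dg).
by rewrite addrC (mulrC a).
Qed.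

Lemma is_derive_addf f g x a b : is_derive x 1 f a -> is_derive x 1 g b ->
  is_derive x 1 (fun y => f y + g y) (a + b).
Proof. by move=> df dg; exact: (is_deriveD df dg). Qed.

Lemma is_derive_mulc f x a b : is_derive x 1 f a ->
  is_derive x 1 (fun y => b * f y) (b * a).
Proof. by move=> df; exact: (is_deriveZ b df). Qed.

Lemma is_derive_compf f g x a b : is_derive (g x) 1 f a ->
  is_derive x 1 g b -> is_derive x 1 (fun y => f (g y)) (a * b).
Proof. by move=> df dg; exact: (is_derive1_comp df dg). Qed.

Lemma is_derive_linear x a : is_derive x 1 (fun y => a * y) a.
Proof. by have := is_derive_mulc a (is_derive_id x 1); rewrite mulr1. Qed.

Lemma is_derive_continuous f (df : R -> R) :
  (forall x, is_derive x 1 f (df x)) -> continuous f.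
Proof.
move=> fd x; apply/differentiable_continuous/derivable1_diffP.
by have [] := fd x.
Qed.

Lemma continuous_linear a : continuous (fun y : R => a * y).
Proof. exact: (is_derive_continuous (fun x => is_derive_linear x a)). Qed.

Lemma is_derive_sqr x : is_derive x 1 (fun y => y ^+ 2) (2 * x).
Proof.
apply: (is_derive_eq (is_derive_mulf (is_derive_id x 1) (is_derive_id x 1))).
by ring.
Qed.

Lemma is_derive_expRN k x :
  is_derive x 1 (fun y => expR (- (k * y))) (expR (- (k * x)) * - k).
Proof.
exact: (@is_derive_compf expR (fun y => - (k * y)) x _ _
  (is_derive_expR _) (is_deriveN (is_derive_linear x k))).
Qed.

Lemma expR_linear_cvg0 (k : R) : 0 < k -> expR (- (k * x)) @[x --> +oo] --> 0.
Proof.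
move=> k0; apply: (cvg_comp (fun x => k * x) (fun y => expR (- y))).
  exact: gt0_cvgMry.
exact: cvgr_expR.
Qed.

End real_derivatives.

Section half_line_calculus.
Context {R : realType}.
Implicit Types (f g F G : R -> R) (l x : R).

Lemma ge0_integral_half_FTC f F l : (forall x, 0 <= x -> 0 <= f x) ->
  (forall x, is_derive x 1 F (f x)) -> continuous f ->
  F x @[x --> +oo] --> l ->
  (\int[half_lebesgue]_x (f x)%:E = (l - F 0)%:E)%E.
Proof.
move=> f0 dF cf Fl.
rewrite integral_half_lebesgue; last first.
  by apply/measurable_EFinP; exact: continuous_measurable_fun.
rewrite (ge0_continuous_FTC2y f0 _ Fl)//.
- exact: continuous_subspaceT.
- by apply: cvg_at_right_filter; exact: (is_derive_continuous dF).
- by move=> x _; rewrite derive1E; have [_] := dF x.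
Qed.

Lemma integrable_half_le f g : measurable_fun setT f -> measurable_fun setT g ->
  (forall x, 0 <= x -> `|f x| <= g x) ->
  (\int[half_lebesgue]_x (g x)%:E < +oo)%E ->
  half_lebesgue.-integrable setT (EFin \o f).
Proof.
move=> mf mg fg goo.
have mf' : measurable_fun setT (fun x => `|f x|) by exact: measurableT_comp.
apply/integrableP; split; first exact/measurable_EFinP.
apply: le_lt_trans goo; rewrite !integral_half_lebesgue//; last 2 first.
- exact/measurable_EFinP.
- by apply: measurableT_comp => //; exact/measurable_EFinP.
apply: ge0_le_integral => //.
- by apply: measurable_funTS; apply/measurable_EFinP.
- by apply: measurable_funTS; apply/measurable_EFinP.
- by move=> x /=; rewrite in_itv/= andbT lee_fin; exact: fg.
Qed.

(** The signed integrand f is the difference of f + g and g, which are both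
    nonnegative and have an antiderivative with a limit at infinity. *)
Lemma integral_half_FTC f F l g G l' : (forall x, 0 <= x -> `|f x| <= g x) ->
  (forall x, is_derive x 1 F (f x)) -> continuous f ->
  F x @[x --> +oo] --> l ->
  (forall x, is_derive x 1 G (g x)) -> continuous g ->
  G x @[x --> +oo] --> l' ->
  half_lebesgue.-integrable setT (EFin \o f) /\
  (\int[half_lebesgue]_x (f x)%:E = (l - F 0)%:E)%E.
Proof.
move=> fg dF cf Fl dG cg Gl'.
have g0 x : 0 <= x -> 0 <= g x by move=> /fg; apply: le_trans.
have mf : measurable_fun setT f by exact: continuous_measurable_fun.
have mg : measurable_fun setT g by exact: continuous_measurable_fun.
have Ig := ge0_integral_half_FTC g0 dG cg Gl'.
have ig : half_lebesgue.-integrable setT (EFin \o g).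
  apply: (integrable_half_le mg mg); last by rewrite Ig ltry.
  by move=> x x0; rewrite ger0_norm// g0.
have iF : half_lebesgue.-integrable setT (EFin \o f).
  by apply: (integrable_half_le mf mg fg); rewrite Ig ltry.
split=> //.
have fg0 x : 0 <= x -> 0 <= f x + g x.
  by move=> /fg; rewrite ler_norml -lerBlDr sub0r => /andP[].
have cfg : continuous (fun x => f x + g x).
  by move=> x; apply: cvgD; [exact: cf|exact: cg].
have FGl : F x + G x @[x --> +oo] --> l + l' by exact: cvgD.
have := ge0_integral_half_FTC fg0 (fun x => is_derive_addf (dF x) (dG x)) cfg FGl.
under eq_integral do rewrite EFinD.
rewrite integralD// Ig => e.
have := congr1 (fun z : \bar R => (z - (l' - G 0)%:E)%E) e.
by rewrite addeK// => ->; rewrite -EFinB; congr EFin; ring.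
Qed.

End half_line_calculus.

Lemma ge0_integral_fold {R : realType} (f : R -> R) : continuous f ->
  (forall x, 0 <= f x) ->
  (\int[@lebesgue_measure R]_x (f x)%:E =
   \int[half_lebesgue]_x (f x + f (- x))%:E)%E.
Proof.
move=> cf f0.
have mf : measurable_fun [set: R] f by exact: continuous_measurable_fun.
have mfN : measurable_fun [set: R] (fun x => f (- x)).
  by apply: (measurableT_comp mf); exact: oppr_measurable.
under [RHS]eq_integral do rewrite EFinD.
rewrite ge0_integralD//; last 4 first.
- by move=> x _; rewrite lee_fin.
- exact/measurable_EFinP.
- by move=> x _; rewrite lee_fin.
- exact/measurable_EFinP.
rewrite !integral_half_lebesgue//; last 2 first.
- exact/measurable_EFinP.
- exact/measurable_EFinP.
have mposnums : measurable [set x : R | 0 <= x]%R by rewrite -set_itvcy.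
rewrite -(setUv [set x : R | 0 <= x]%R) ge0_integral_setU//= ; last 4 first.
- exact: measurableC.
- by apply/measurable_EFinP; rewrite setUv.
- by move=> x _; rewrite lee_fin.
- exact/disj_setPCl.
rewrite -set_itvcy//; congr (_ + _)%E.
rewrite setCitvr integral_itv_bndo_bndc; last first.
  exact/measurable_EFinP/measurable_funTS.
rewrite -{1}oppr0 ge0_integration_by_substitutionNy//.
exact: continuous_subspaceT.
Qed.

(** The signed case follows from the nonnegative one applied to f + g and
    to g. *)
Lemma integral_fold {R : realType} (f g : R -> R) : continuous f -> continuous g ->
  (forall x, `|f x| <= g x) ->
  (@lebesgue_measure R).-integrable setT (EFin \o g) ->
  (\int[@lebesgue_measure R]_x (f x)%:E =
   \int[half_lebesgue]_x (f x + f (- x))%:E)%E.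
Proof.
move=> cf cg fg ig.
have mf : measurable_fun [set: R] f by exact: continuous_measurable_fun.
have mg : measurable_fun [set: R] g by exact: continuous_measurable_fun.
have mopp : measurable_fun [set: R] (@GRing.opp R).
  exact: oppr_measurable.
have g0 x : 0 <= g x by apply: le_trans (fg x).
have iF : (@lebesgue_measure R).-integrable setT (EFin \o f).
  exact: dominated_integrable ig.
have := ge0_integral_fold cg g0; have Ig := integrable_integral ig.
have cfg : continuous (fun x => f x + g x).
  by move=> x; apply: cvgD; [exact: cf|exact: cg].
have := ge0_integral_fold cfg.
have fg0 x : 0 <= f x + g x.
  by have := fg x; rewrite ler_norml -lerBlDr sub0r => /andP[].
move=> /(_ fg0).
under eq_integral do rewrite EFinD.
rewrite integralD//.
have igg : half_lebesgue.-integrable setT (EFin \o (fun x => g x + g (- x))).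
  have mgg : measurable_fun setT (fun x => g x + g (- x)).
    by apply: measurable_funD => //; exact: (measurableT_comp mg).
  apply: (integrable_half_le mgg mgg) => [x _|].
    by rewrite ger0_norm ?addr_ge0.
  by rewrite -ge0_integral_fold// Ig ltry.
have iff : half_lebesgue.-integrable setT (EFin \o (fun x => f x + f (- x))).
  apply: dominated_integrable igg.
    by apply: measurable_funD => //; exact: (measurableT_comp mf).
  by move=> x; rewrite (le_trans (ler_normD _ _))// lerD.
under [in X in _ = X -> _]eq_integral do rewrite addrACA EFinD.
rewrite integralD// => h1 h2; rewrite h2 in h1.
have := congr1 (fun z : \bar R => (z -
  \int[half_lebesgue]_x (g x + g (- x))%:E)%E) h1.
by rewrite !addeK//; exact: integrable_fin_num igg.
Qed.

(** * The Laplace transform of a cosine and a sine *)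

Lemma expR_bounded_cvg0 {R : realType} (k M : R) (h : R -> R) : 0 < k ->
  (forall x, `|h x| <= M) -> expR (- (k * x)) * h x @[x --> +oo] --> 0.
Proof.
move=> k0 hM; apply: norm_cvg0.
have eM : expR (- (k * x)) * M @[x --> +oo] --> 0.
  by rewrite -(mul0r M); apply: cvgMl; exact: expR_linear_cvg0.
apply: (squeeze_cvgr _ (cvg_cst 0) eM); apply: nearW => x.
by rewrite normr_ge0 normrM (ger0_norm (expR_ge0 _)) ler_wpM2l ?expR_ge0.
Qed.

Section laplace_transform.
Context {R : realType}.
Variables (beta alpha : R).
Hypothesis beta_gt0 : 0 < beta.

(** Normalised so that its integral against e^(- 2 i pi alpha r) over r >= 0
    is 1 / (beta + i alpha). *)
Definition laplace_weight (r : R) : R := 2 * pi * expR (- (2 * pi * beta * r)).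

Lemma laplace_weight_ge0 r : 0 <= laplace_weight r.
Proof. by rewrite mulr_ge0 ?mulr_ge0 ?pi_ge0 ?expR_ge0. Qed.

Let k := 2 * pi * beta.
Let k_gt0 : 0 < k. Proof. by rewrite !mulr_gt0 ?pi_gt0. Qed.

Let N := beta ^+ 2 + alpha ^+ 2.
Let N_gt0 : 0 < N. Proof. by rewrite ltr_wpDr ?sqr_ge0 ?exprn_gt0. Qed.

(** An antiderivative is - Re((p + i q) e^(- 2 pi (beta + i alpha) r) /
    (beta + i alpha)), which is F in the proof. *)
Lemma laplace_trig (p q : R) :
  half_lebesgue.-integrable setT (EFin \o (fun r : R =>
    laplace_weight r * (p * cos (2 * pi * alpha * r) + q * sin (2 * pi * alpha
        * r)))) /\
  (\int[half_lebesgue]_r (laplace_weight r *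
     (p * cos (2 * pi * alpha * r) + q * sin (2 * pi * alpha * r)))%:E =
   ((p * beta + q * alpha) / N)%:E)%E.
Proof.
set w := 2 * pi * alpha.
pose F (r : R) := N^-1 * (expR (- (k * r)) *
  ((alpha * q + beta * p) * - cos (w * r) + (alpha * p - beta * q) * sin (w * r))).
have dcos (x : R) : is_derive x 1 (fun y => cos (w * y)) (- sin (w * x) * w).
  exact: (is_derive_compf (is_derive_cos _) (is_derive_linear x w)).
have dsin (x : R) : is_derive x 1 (fun y => sin (w * y)) (cos (w * x) * w).
  exact: (is_derive_compf (is_derive_sin _) (is_derive_linear x w)).
have ccos := is_derive_continuous dcos; have csin := is_derive_continuous dsin.
have cexp := is_derive_continuous (is_derive_expRN k).
have cw : continuous laplace_weight.
  by move=> x; apply: cvgM; [exact: cvg_cst|exact: cexp].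
pose f r := laplace_weight r * (p * cos (w * r) + q * sin (w * r)).
have dF (x : R) : is_derive x 1 F (f x).
  apply: (is_derive_eq (is_derive_mulc N^-1 (is_derive_mulf (is_derive_expRN k x)
    (is_derive_addf (is_derive_mulc (alpha * q + beta * p) (is_deriveN (dcos x)))
       (is_derive_mulc (alpha * p - beta * q) (dsin x)))))).
  rewrite /f /laplace_weight -/k /=.
  rewrite fctE; set C := cos _; set S := sin _; set E := expR _.
  by rewrite /w /k /N; field; rewrite gt_eqF.
have := @integral_half_FTC R f F 0 (fun r => (`|p| + `|q|) * laplace_weight r)
  (fun r => (- (`|p| + `|q|) / beta) * expR (- (k * r))) 0.
rewrite (_ : 0 - F 0 = (p * beta + q * alpha) / N); last first.
  rewrite /F !mulr0 oppr0 expR0 cos0 sin0; ring.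
apply => //.
- move=> x _; rewrite normrM (ger0_norm (laplace_weight_ge0 _)) mulrC.
  by rewrite ler_wpM2r ?laplace_weight_ge0 ?normr_trig_le.
- move=> x; apply: cvgM; first exact: cw.
  by apply: cvgD; apply: cvgM; [exact: cvg_cst|exact: ccos|exact:
      cvg_cst|exact: csin].
- rewrite -(mulr0 N^-1); apply: cvgMr.
  apply: (@expR_bounded_cvg0 _ k (`|alpha * q + beta * p| + `|alpha * p - beta
      * q|)) => //.
  move=> x; rewrite mulrN -mulNr -(normrN (alpha * q + _)).
  exact: normr_trig_le.
- move=> x.
  apply: (is_derive_eq (is_derive_mulc (- (`|p| + `|q|) / beta)
      (is_derive_expRN k x))).
  rewrite /laplace_weight /k.
  by field; rewrite gt_eqF.
- by move=> x; apply: cvgM; [exact: cvg_cst|exact: cw].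
- rewrite -(mulr0 (- (`|p| + `|q|) / beta)); apply: cvgMr.
  exact: expR_linear_cvg0.
Qed.
End laplace_transform.

(** * The Fourier transform of the Gaussian *)

Section gauss_fourier.
Context {R : realType}.
Implicit Types (x t k : R).

Definition gauss_weight t : R := expR (- (pi * t ^+ 2)).

Lemma gauss_weight_ge0 t : 0 <= gauss_weight t. Proof. exact: expR_ge0. Qed.

Lemma is_derive_gauss_weight t :
  is_derive t 1 gauss_weight (gauss_weight t * - (2 * pi * t)).
Proof.
apply: (is_derive_eq (@is_derive_compf _ expR (fun y => - (pi * y ^+ 2)) t _ _
  (is_derive_expR _) (is_deriveN (is_derive_mulc pi (is_derive_sqr t))))).
by rewrite /gauss_weight; ring.
Qed.

Lemma continuous_gauss_weight : continuous gauss_weight.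
Proof. exact: is_derive_continuous is_derive_gauss_weight. Qed.

(** From (t - 1)^2 >= 0. Contrary to the Gaussian itself, this majorant has an
    elementary antiderivative. *)
Lemma gauss_weight_le t : gauss_weight t <= expR pi * expR (- (2 * pi * t)).
Proof.
rewrite /gauss_weight -expRD ler_expR.
have -> : pi - 2 * pi * t = - (pi * t ^+ 2) + pi * (t - 1) ^+ 2 :> R by ring.
by rewrite lerDl mulr_ge0 ?pi_ge0 ?sqr_ge0.
Qed.

Lemma gauss_weight_cvg0 : gauss_weight t @[t --> +oo] --> 0.
Proof.
have pi2 : 0 < 2 * pi :> R by rewrite mulr_gt0 ?pi_gt0.
have h : expR pi * expR (- (2 * pi * t)) @[t --> +oo] --> (0 : R).
  by rewrite -(mulr0 (expR pi)); apply: cvgMr; exact: expR_linear_cvg0.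
apply: (squeeze_cvgr _ (cvg_cst 0) h); apply: nearW => t.
by rewrite gauss_weight_ge0 gauss_weight_le.
Qed.

(** The weight is the density of the centred normal law of variance
    1 / (2 pi). *)
Lemma integral_gauss_weight :
  (\int[@lebesgue_measure R]_t (gauss_weight t)%:E = 1)%E.
Proof.
pose s : R := (Num.sqrt (2 * pi))^-1.
have pi2 : 0 < 2 * pi :> R by rewrite mulr_gt0 ?pi_gt0.
have pi0 : pi != 0 :> R by rewrite gt_eqF// pi_gt0.
have s2 : s ^+ 2 = (2 * pi)^-1 by rewrite exprVn sqr_sqrtr// ltW.
have s0 : s != 0 by rewrite invr_eq0 sqrtr_eq0 -ltNge.
rewrite -[RHS](integral_normal_pdf 0 s); apply: eq_integral => t _.
rewrite normal_pdfE// /normal_peak /normal_fun s2 subr0.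
have -> : (2 * pi)^-1 * pi *+ 2 = 1 :> R.
  by rewrite -mulr_natr; move: (pi : R) pi0 => p p0; field.
rewrite /= sqrtr1 invr1 mul1r /gauss_weight; congr (expR _)%:E.
by rewrite -mulr_natr; move: (pi : R) pi0 => p p0; field.
Qed.

Lemma integrable_gauss_weight :
  (@lebesgue_measure R).-integrable setT (EFin \o gauss_weight).
Proof.
apply/integrableP; split.
  apply/measurable_EFinP; apply: continuous_measurable_fun.
  exact: continuous_gauss_weight.
under eq_integral do rewrite /= ger0_norm ?gauss_weight_ge0//.
by rewrite integral_gauss_weight ltry.
Qed.

Lemma integral_half_gauss_weight :
  (\int[half_lebesgue]_t (gauss_weight t)%:E = (2^-1 : R)%:E)%E.
Proof.
have mw : measurable_fun setT gauss_weight.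
  by apply: continuous_measurable_fun; exact: continuous_gauss_weight.
have := ge0_integral_fold continuous_gauss_weight gauss_weight_ge0.
rewrite integral_gauss_weight.
under eq_integral do rewrite {2}/gauss_weight sqrrN -/(gauss_weight _) -mulr2n
  -mulr_natl EFinM.
rewrite ge0_integralZl//; last 2 first.
- exact/measurable_EFinP.
- by move=> t _; rewrite lee_fin gauss_weight_ge0.
move=> h; have := congr1 (fun z : \bar R => (2^-1%:E * z)%E) h.
by rewrite /= mule1 muleA -EFinM mulVf ?pnatr_eq0// mul1e => ->.
Qed.

Lemma integrable_half_gauss_weight :
  half_lebesgue.-integrable setT (EFin \o gauss_weight).
Proof.
have mw : measurable_fun setT gauss_weight.
  by apply: continuous_measurable_fun; exact: continuous_gauss_weight.
apply: (integrable_half_le mw mw) => [t _|]; last first.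
  by rewrite integral_half_gauss_weight ltry.
by rewrite ger0_norm ?gauss_weight_ge0.
Qed.

Let dcos k x : is_derive x 1 (fun y => cos (2 * pi * k * y)) (- sin (2 * pi * k
    * x) * (2 * pi * k)).
Proof. exact: (is_derive_compf (is_derive_cos _) (is_derive_linear x _)). Qed.
Let dsin k x : is_derive x 1 (fun y => sin (2 * pi * k * y)) (cos (2 * pi * k *
    x) * (2 * pi * k)).
Proof. exact: (is_derive_compf (is_derive_sin _) (is_derive_linear x _)). Qed.
Let ccos k := is_derive_continuous (dcos k).
Let csin k := is_derive_continuous (dsin k).
Let mcos k : measurable_fun setT (fun t => cos (2 * pi * k * t)).
Proof. by apply: continuous_measurable_fun; exact: ccos. Qed.
Let msin k : measurable_fun setT (fun t => sin (2 * pi * k * t)).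
Proof. by apply: continuous_measurable_fun; exact: csin. Qed.
Let mw : measurable_fun setT gauss_weight.
Proof. by apply: continuous_measurable_fun; exact: continuous_gauss_weight. Qed.

Let tgauss t := 2 * pi * t * gauss_weight t.

Let ctgauss : continuous tgauss.
Proof.
move=> t; apply: cvgM; last exact: continuous_gauss_weight.
exact: continuous_linear.
Qed.

Let dNgauss t : is_derive t 1 (fun y => - gauss_weight y) (tgauss t).
Proof.
apply: (is_derive_eq (is_deriveN (is_derive_gauss_weight t))).
by rewrite /tgauss; ring.
Qed.

Let tgauss_ge0 t : 0 <= t -> 0 <= tgauss t.
Proof. by move=> t0; rewrite !mulr_ge0 ?pi_ge0 ?gauss_weight_ge0. Qed.

Let Ngauss_cvg0 : - gauss_weight t @[t --> +oo] --> 0.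
Proof. by rewrite -oppr0; apply: cvgN; exact: gauss_weight_cvg0. Qed.

Let half_cos k : R := \int[half_lebesgue]_t (gauss_weight t * cos (2 * pi * k * t)).

Let integrable_half_cos k :
  half_lebesgue.-integrable setT (EFin \o (fun t => gauss_weight t * cos (2 *
      pi * k * t))).
Proof.
apply: dominated_integrable integrable_half_gauss_weight.
  by apply: measurable_funM; [exact: mw|exact: mcos].
by move=> t; rewrite normrM ger0_norm ?gauss_weight_ge0// ler_piMr
    ?gauss_weight_ge0//
  normr_cos_le1.
Qed.

(** Integration by parts: the boundary term of the antiderivative
    e^(- pi t^2) sin (2 pi k t) vanishes at 0 and at infinity. *)
Let integrable_half_tsin k :
  half_lebesgue.-integrable setT (EFin \o (fun t => tgauss t * sin (2 * pi * k
      * t))) /\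
  \int[half_lebesgue]_t (tgauss t * sin (2 * pi * k * t)) = 2 * pi * k * half_cos k.
Proof.
pose F t := gauss_weight t * sin (2 * pi * k * t).
pose f t := 2 * pi * k * (gauss_weight t * cos (2 * pi * k * t)) - tgauss t *
    sin (2 * pi * k * t).
(* the factor expR pi is the constant of gauss_weight_le *)
pose M := `|k| * expR pi.
pose G t := - gauss_weight t - M * expR (- (2 * pi * t)).
pose g t := tgauss t + M * (2 * pi) * expR (- (2 * pi * t)).
have dF t : is_derive t 1 F (f t).
  apply: (is_derive_eq (is_derive_mulf (is_derive_gauss_weight t) (dsin k t))).
  by rewrite /f /tgauss; ring.
have de := @is_derive_expRN R (2 * pi).
have dG t : is_derive t 1 G (g t).
  apply: (is_derive_eq (is_derive_addf (dNgauss t) (is_deriveN (is_derive_mulc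
      M (de t))))).
  by rewrite /g; ring.
have cf : continuous f.
  move=> t; apply: cvgB; apply: cvgM; [exact: cvg_cst| |exact: ctgauss|exact: csin].
  by apply: cvgM; [exact: continuous_gauss_weight|exact: ccos].
have cg : continuous g.
  move=> t; apply: cvgD; first exact: ctgauss.
  by apply: cvgM; [exact: cvg_cst|exact: (is_derive_continuous de)].
have fg t : 0 <= t -> `|f t| <= g t.
  move=> t0; rewrite /f /g addrC (le_trans (ler_normD _ _))// lerD//.
    rewrite normrN normrM (ger0_norm (tgauss_ge0 t0)).
    by rewrite ler_piMr ?tgauss_ge0// normr_sin_le1.
  have -> : M * (2 * pi) * expR (- (2 * pi * t)) =
      2 * pi * `|k| * (expR pi * expR (- (2 * pi * t))) by rewrite /M; ring.
  rewrite normrM normrM (@ger0_norm _ (2 * pi)) ?mulr_ge0 ?pi_ge0//.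
  rewrite ler_wpM2l ?mulr_ge0 ?pi_ge0//.
  rewrite (le_trans _ (gauss_weight_le t))// normrM ger0_norm ?gauss_weight_ge0//.
  by rewrite ler_piMr ?gauss_weight_ge0// normr_cos_le1.
have F0 : F t @[t --> +oo] --> 0.
  apply: norm_cvg0; apply: (squeeze_cvgr _ (cvg_cst 0) gauss_weight_cvg0).
  apply: nearW => t; rewrite normr_ge0 normrM ger0_norm ?gauss_weight_ge0//.
  by rewrite ler_piMr ?gauss_weight_ge0// normr_sin_le1.
have G0 : G t @[t --> +oo] --> 0.
  rewrite -(subr0 0); apply: cvgB; first exact: Ngauss_cvg0.
  rewrite -(mulr0 M); apply: cvgMr; apply: expR_linear_cvg0.
  by rewrite !mulr_gt0 ?pi_gt0.
have [iF If] := integral_half_FTC fg dF cf F0 dG cg G0.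
have it : half_lebesgue.-integrable setT (EFin \o (fun t => tgauss t * sin (2 *
    pi * k * t))).
  have mtg : measurable_fun setT tgauss by exact: continuous_measurable_fun.
  apply: (integrable_half_le _ mtg); first by apply: measurable_funM; [exact:
      mtg|exact: msin].
    move=> t t0; rewrite normrM (ger0_norm (tgauss_ge0 t0)).
    by rewrite ler_piMr ?tgauss_ge0// normr_sin_le1.
  by rewrite (ge0_integral_half_FTC tgauss_ge0 dNgauss ctgauss Ngauss_cvg0) ltry.
split=> //.
have := If; rewrite /F mulr0 sin0 mulr0 subr0 (integrable_integral iF) => -[].
have ic : half_lebesgue.-integrable setT (EFin \o
    (fun t => 2 * pi * k * (gauss_weight t * cos (2 * pi * k * t)))).
  rewrite /comp; under eq_fun do rewrite EFinM.
  by apply: integrableZl => //; exact: integrable_half_cos.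
rewrite /f (RintegralB measurableT ic it).
rewrite (RintegralZl _ measurableT (integrable_half_cos k)).
by rewrite -/(half_cos k) => /eqP; rewrite subr_eq0 => /eqP.
Qed.

(** Differentiation under the integral sign, followed by the integration by
    parts above. *)
Let is_derive_half_cos k : is_derive k 1 half_cos (- (2 * pi * k * half_cos k)).
Proof.
pose f k t := gauss_weight t * cos (2 * pi * k * t).
have df k' t : is_derive k' 1 (f ^~ t) (- (tgauss t * sin (2 * pi * k' * t))).
  have h : is_derive k' 1 (fun y => 2 * pi * y * t) (2 * pi * t).
    rewrite (_ : (fun y => _) = (fun y => 2 * pi * t * y)).
      exact: is_derive_linear.
    by apply/funext => y; ring.
  apply: (is_derive_eq (is_derive_mulc (gauss_weight t)
    (is_derive_compf (is_derive_cos _) h))).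
  by rewrite /tgauss; ring.
have kI : `]k - 1, k + 1[%classic k.
  by rewrite /= in_itv/= ltrDl ltr01 ltrBlDr ltrDl ltr01.
have intG : half_lebesgue.-integrable setT (EFin \o (fun t => `|tgauss t|)).
  have mtg : measurable_fun setT tgauss by exact: continuous_measurable_fun.
  apply: (integrable_half_le (measurableT_comp _ mtg) mtg) => //.
    by move=> t t0; rewrite normr_id ger0_norm ?tgauss_ge0.
  by rewrite (ge0_integral_half_FTC tgauss_ge0 dNgauss ctgauss Ngauss_cvg0) ltry.
have intf x : `]k - 1, k + 1[%classic x ->
    half_lebesgue.-integrable setT (EFin \o f x).
  by move=> _; exact: integrable_half_cos.
have derf1 x t : `]k - 1, k + 1[%classic x -> setT t -> derivable (f ^~ t) x 1.
  by move=> _ _; have [] := df x t.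
have ub x t : `]k - 1, k + 1[%classic x -> setT t -> `|partial1of2 f x t| <=
    `|tgauss t|.
  move=> _ _; rewrite partial1of2E; have [_ ->] := df x t.
  by rewrite normrN normrM ler_piMr// normr_sin_le1.
have d1 := @derivable_under_integral _ _ _ half_lebesgue f setT measurableT
  k (k - 1) (k + 1) kI intf derf1 (fun t => `|tgauss t|) (fun t => normr_ge0 _)
      intG ub.
have d2 := @differentiation_under_integral _ _ _ half_lebesgue f setT measurableT
  k (k - 1) (k + 1) kI intf derf1 (fun t => `|tgauss t|) (fun t => normr_ge0 _)
      intG ub.
apply: DeriveDef; first exact: d1.
rewrite -derive1E [LHS]d2.
have [it <-] := integrable_half_tsin k.
rewrite -[RHS]mulN1r -RintegralZl//.
apply: eq_Rintegral => t _; rewrite partial1of2E mulN1r.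
by have [_ ->] := df k t.
Qed.

(** By its differential equation the left-hand side, multiplied by
    e^(pi k^2), does not depend on k. *)
Lemma integral_half_gauss_cos k :
  \int[half_lebesgue]_t (gauss_weight t * cos (2 * pi * k * t)) =
  2^-1 * expR (- (pi * k ^+ 2)).
Proof.
rewrite -/(half_cos k).
have dE x : is_derive x 1 (fun y => expR (pi * y ^+ 2)) (expR (pi * x ^+ 2) *
    (2 * pi * x)).
  apply: (is_derive_eq (@is_derive_compf _ expR (fun y => pi * y ^+ 2) x _ _
    (is_derive_expR _) (is_derive_mulc pi (is_derive_sqr x)))).
  by ring.
have h x : is_derive x 1 (fun y => half_cos y * expR (pi * y ^+ 2)) 0.
  by apply: (is_derive_eq (is_derive_mulf (is_derive_half_cos x) (dE x))); ring.
have h0 : half_cos 0 = 2^-1.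
  apply: EFin_inj; rewrite -integral_half_gauss_weight.
  rewrite (integrable_integral integrable_half_gauss_weight); congr EFin.
  by apply: eq_Rintegral => t _; rewrite mulr0 mul0r cos0 mulr1.
have := is_derive_0_is_cst k 0 h; rewrite expr0n /= mulr0 expR0 mulr1 h0 => <-.
by rewrite -mulrA -expRD subrr expR0 mulr1.
Qed.

Lemma integral_gauss_cos k :
  (\int[@lebesgue_measure R]_t (gauss_weight t * cos (2 * pi * k * t))%:E =
   (expR (- (pi * k ^+ 2)))%:E)%E.
Proof.
rewrite (@integral_fold _ _ gauss_weight).
- transitivity (\int[half_lebesgue]_t
      (2 * (gauss_weight t * cos (2 * pi * k * t)))%:E)%E.
    apply: eq_integral => t _; congr EFin.
    by rewrite /gauss_weight sqrrN mulrN cosN; ring.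
  have ic : half_lebesgue.-integrable setT (EFin \o
      (fun t => 2 * (gauss_weight t * cos (2 * pi * k * t)))).
    rewrite /comp; under eq_fun do rewrite EFinM.
    by apply: integrableZl => //; exact: integrable_half_cos.
  rewrite (integrable_integral ic).
  rewrite (RintegralZl _ measurableT (integrable_half_cos k)).
  by rewrite integral_half_gauss_cos mulrA divff// mul1r.
- by move=> t; apply: cvgM; [exact: continuous_gauss_weight|exact: ccos].
- exact: continuous_gauss_weight.
- move=> t; rewrite normrM ger0_norm ?gauss_weight_ge0//.
  by rewrite ler_piMr ?gauss_weight_ge0// normr_cos_le1.
- exact: integrable_gauss_weight.
Qed.

Lemma integral_gauss_sin k :
  (\int[@lebesgue_measure R]_t (gauss_weight t * sin (2 * pi * k * t))%:E = 0)%E.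
Proof.
rewrite (@integral_fold _ _ gauss_weight).
- under eq_integral do rewrite {2}/gauss_weight sqrrN -/(gauss_weight _) mulrN sinN
    mulrN subrr.
  by rewrite integral0.
- by move=> t; apply: cvgM; [exact: continuous_gauss_weight|exact: csin].
- exact: continuous_gauss_weight.
- move=> t; rewrite normrM ger0_norm ?gauss_weight_ge0//.
  by rewrite ler_piMr ?gauss_weight_ge0// normr_sin_le1.
- exact: integrable_gauss_weight.
Qed.

End gauss_fourier.

(** * Derivatives of the Gaussian along a ray *)

Section one_dimensional.
Context {R : realType}.
Implicit Types (x s c q : R).

Lemma measurable_invsqrt : measurable_fun [set: R] (fun x => (Num.sqrt x)^-1).
Proof.
rewrite (_ : (fun x => _) = (fun y => y `^ (-1)) \o Num.sqrt); last first.
  by apply/funext => x /=; rewrite powR_inv1// sqrtr_ge0.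
apply: (measurableT_comp (measurable_powR _)).
by apply: continuous_measurable_fun; exact: sqrt_continuous.
Qed.

(** Completing the square. It bounds a Gaussian in s, up to a factor
    polynomial in s, by a multiple of e^(- s), whose antiderivative is known. *)
Lemma quadratic_le_linear q c c0 : 0 < q -> exists K : R,
  forall s : R, c0 + c * s - pi * q * s ^+ 2 <= K - s.
Proof.
move=> q0; exists (c0 + (c + 1) ^+ 2 / (4 * (pi * q))) => s.
have pq : 0 < pi * q by rewrite mulr_gt0 ?pi_gt0.
rewrite -subr_ge0.
have -> : c0 + (c + 1) ^+ 2 / (4 * (pi * q)) - s - (c0 + c * s - pi * q * s ^+ 2) =
  pi * q * (s - (c + 1) / (2 * (pi * q))) ^+ 2.
  by move: (pi * q) pq => p p0; field; rewrite gt_eqF.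
by rewrite mulr_ge0 ?sqr_ge0// ltW.
Qed.

(** The integrand is the derivative in s of - e^(- pi Q(z + s D)), where
    c0 = Q z, c = B(D, z) and q = Q D. *)
Lemma half_gauss_FTC q c c0 : 0 < q ->
  (\int[half_lebesgue]_s (2 * pi * (c + s * q) *
     expR (- (pi * (c0 + 2 * s * c + s ^+ 2 * q))))%:E =
   (expR (- (pi * c0)))%:E)%E.
Proof.
move=> q0.
pose E s := expR (- (pi * (c0 + 2 * s * c + s ^+ 2 * q))).
have dE s : is_derive s 1 E (E s * - (2 * pi * (c + s * q))).
  have dp : is_derive s 1 (fun y => c0 + 2 * y * c + y ^+ 2 * q) (2 * c + 2 * s
      * q).
    apply: (is_derive_eq (is_derive_addf (is_derive_addf (is_derive_cst c0 s 1)
      (is_derive_mulf (is_derive_linear s 2) (is_derive_cst c s 1)))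
      (is_derive_mulf (is_derive_sqr s) (is_derive_cst q s 1)))).
    by rewrite /=; ring.
  apply: (is_derive_eq (@is_derive_compf _ expR _ s _ _
    (is_derive_expR _) (is_deriveN (is_derive_mulc pi dp)))).
  by rewrite fctE /E; ring.
have cE := is_derive_continuous dE.
pose f s := 2 * pi * (c + s * q) * E s.
have dF s : is_derive s 1 (fun s => - E s) (f s).
  by apply: (is_derive_eq (is_deriveN (dE s))); rewrite /f; ring.
have cf : continuous f.
  move=> s; apply: cvgM; last exact: cE.
  apply: cvgM; first exact: cvg_cst.
  apply: cvgD; first exact: cvg_cst.
  apply: cvgM; last exact: cvg_cst.
  exact: cvg_id.
have [K hK] := @quadratic_le_linear q (q - 2 * pi * c) (`|c| - pi * c0) q0.
have [K1 hK1] := @quadratic_le_linear q (- 2 * pi * c) (- pi * c0) q0.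
have e0 (M : R) : M * expR (- (1 * s)) @[s --> +oo] --> 0.
  by rewrite -(mulr0 M); apply: cvgMr; exact: expR_linear_cvg0.
have F0 : - E s @[s --> +oo] --> 0.
  rewrite -oppr0; apply: cvgN.
  apply: (squeeze_cvgr _ (cvg_cst 0) (e0 (expR K1))); apply: nearW => s.
  rewrite expR_ge0 /E -expRD ler_expR mul1r (le_trans _ (hK1 s))//.
  by rewrite le_eqVlt; apply/orP; left; apply/eqP; ring.
have de := @is_derive_expRN R 1.
have := @integral_half_FTC R f (fun s => - E s) 0
  (fun s => 2 * pi * expR K * expR (- (1 * s)))
  (fun s => - (2 * pi * expR K) * expR (- (1 * s))) 0.
rewrite (_ : 0 - - E 0 = expR (- (pi * c0))); last first.
  by rewrite sub0r opprK /E; congr expR; ring.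
case=> //.
- move=> s s0; rewrite normrM normrM (@ger0_norm _ (2 * pi)) ?mulr_ge0 ?pi_ge0//.
  rewrite (ger0_norm (expR_ge0 _)) -!mulrA ler_wpM2l// ler_wpM2l ?pi_ge0//.
  have h : `|c + s * q| <= expR (`|c| + s * q).
    apply: (@le_trans _ _ (`|c| + s * q)).
      by rewrite (le_trans (ler_normD _ _))// (@ger0_norm _ (s * q))//
          mulr_ge0// ltW.
    by rewrite (le_trans _ (expR_ge1Dx _))// lerDr.
  apply: (le_trans (ler_wpM2r (expR_ge0 _) h)).
  rewrite /E -!expRD ler_expR mul1r (le_trans _ (hK s))//.
  by rewrite le_eqVlt; apply/orP; left; apply/eqP; ring.
- move=> s; apply: (is_derive_eq (is_derive_mulc _ (de s))).
  by ring.
- by move=> s; apply: cvgM; [exact: cvg_cst|exact: (is_derive_continuous de)].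
Qed.

(** The integrand is the derivative in w of - e^(- pi Q((sqrt w) x + z)),
    where A = Q x, b = B(x, z) and S = Q z. *)
Lemma omega_FTC (A b S a : R) : 0 < A -> 0 <= b -> 0 <= S -> 0 < a ->
  (\int[@lebesgue_measure R]_(w in `[a, +oo[)
     (pi * (A + b / Num.sqrt w) * expR (- (pi * (w * A + 2 * Num.sqrt w * b +
         S))))%:E =
   (expR (- (pi * (a * A + 2 * Num.sqrt a * b + S))))%:E)%E.
Proof.
move=> A0 b0 S0 a0.
pose E w := expR (- (pi * (w * A + 2 * Num.sqrt w * b + S))).
pose f w := pi * (A + b / Num.sqrt w) * E w.
have dE (w : R) : 0 < w -> is_derive w 1 (fun w => - E w) (f w).
  move=> w0.
  have sw : Num.sqrt w != 0 by rewrite sqrtr_eq0 -ltNge.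
  have dp : is_derive w 1 (fun w => w * A + 2 * Num.sqrt w * b + S) (A + b /
      Num.sqrt w).
    apply: (is_derive_eq (is_derive_addf (is_derive_addf
      (is_derive_mulf (is_derive_id w 1) (is_derive_cst A w 1))
      (is_derive_mulf (is_derive_mulc 2 (is_derive1_sqrt w0)) (is_derive_cst b
          w 1)))
      (is_derive_cst S w 1))).
    by rewrite /=; field.
  apply: (is_derive_eq (is_deriveN (@is_derive_compf _ expR _ w _ _
    (is_derive_expR _) (is_deriveN (is_derive_mulc pi dp))))).
  by rewrite fctE /f /E; ring.
have cE (w : R) : 0 < w -> {for w, continuous (fun w => - E w)}.
  move=> w0; apply/differentiable_continuous/derivable1_diffP.
  by have [] := dE w w0.
have cf (w : R) : 0 < w -> {for w, continuous f}.
  move=> w0; apply: cvgM; last first.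
    rewrite (_ : E = (fun w => - - E w)); last by apply/funext => y; rewrite opprK.
    exact: cvgN (cE w w0).
  apply: cvgM; first exact: cvg_cst.
  apply: cvgD; first exact: cvg_cst.
  apply: cvgM; first exact: cvg_cst.
  apply: cvgV; last exact: sqrt_continuous.
  by rewrite sqrtr_eq0 -ltNge.
rewrite (@ge0_continuous_FTC2y _ f (fun w => - E w) a 0).
- by rewrite -EFinB sub0r opprK.
- move=> w aw; have w0 := lt_le_trans a0 aw.
  rewrite mulr_ge0 ?expR_ge0// mulr_ge0 ?pi_ge0// addr_ge0 ?(ltW A0)//.
  by rewrite divr_ge0 ?sqrtr_ge0.
- apply: continuous_in_subspaceT => w; rewrite inE/= in_itv/= andbT => aw.
  by apply: cf; exact: lt_le_trans aw.
- rewrite -oppr0; apply: cvgN.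
  have pA : 0 < pi * A by rewrite mulr_gt0 ?pi_gt0.
  apply: (squeeze_cvgr _ (cvg_cst 0) (expR_linear_cvg0 pA)); near=> w.
  rewrite expR_ge0 ler_expR lerN2 -mulrA ler_wpM2l ?pi_ge0// mulrC -addrA lerDl.
  by rewrite addr_ge0// !mulr_ge0 ?sqrtr_ge0.
- by move=> w aw; have [] := dE w (lt_trans a0 aw).
- by apply: cvg_at_right_filter; exact: cE.
- move=> w; rewrite in_itv/= andbT => aw; rewrite derive1E.
  by have [_] := dE w (lt_trans a0 aw).
Unshelve. all: by end_near.
Qed.

End one_dimensional.

(** * Integration over the positive orthant *)

Section orthant.
Context {R : realType}.
Local Notation tup n := (n.-tuple (measurableTypeR R)).
Local Notation orth n := (power_measure n (@half_lebesgue R)).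

(** Each factor of the measure ignores the negative half-line. *)
Lemma ge0_eq_integral_orthant n (f g : tup n -> \bar R) :
  measurable_fun setT f -> measurable_fun setT g ->
  (forall r, 0 <= f r)%E -> (forall r, 0 <= g r)%E ->
  (forall r : tup n, (forall k, 0 <= (tnth r k : R)) -> f r = g r) ->
  (\int[orth n]_r f r = \int[orth n]_r g r)%E.
Proof.
elim: n => [|n IH] in f g *.
  by move=> mf mg f0 g0 fg; rewrite !integral_power0// fg// => -[].
move=> mf mg f0 g0 fg.
have mt := @measurable_tcons _ (measurableTypeR R) n.
have mf' : measurable_fun setT (fun p : measurableTypeR R * tup n => f (tcons p)).
  exact: measurableT_comp.
have mg' : measurable_fun setT (fun p : measurableTypeR R * tup n => g (tcons p)).
  exact: measurableT_comp.
rewrite !ge0_integral_power_cons// !fubini_tonelli1//.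
rewrite !integral_half_lebesgue; last 2 first.
- exact: measurable_fun_fubini_tonelli_F.
- exact: measurable_fun_fubini_tonelli_F.
apply: eq_integral => a; rewrite inE/= in_itv/= andbT => a0.
have mtc (h : tup n.+1 -> \bar R) : measurable_fun setT h ->
    measurable_fun setT (fun t : tup n => h (tcons (a, t))).
  move=> mh; apply: (measurableT_comp mh).
  by apply: measurable_cons; [exact: measurable_cst|exact: measurable_id].
apply: IH => //; [exact: mtc|exact: mtc|] => r r0.
apply: fg => k; have [j ->|->] := unliftP ord0 k; first by rewrite tnthS.
by rewrite tnth0.
Qed.

Lemma eq_integral_orthant n (f g : tup n -> \bar R) :
  measurable_fun setT f -> measurable_fun setT g ->
  (forall r : tup n, (forall k, 0 <= (tnth r k : R)) -> f r = g r) ->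
  (\int[orth n]_r f r = \int[orth n]_r g r)%E.
Proof.
move=> mf mg fg; rewrite [LHS]integralE [RHS]integralE.
congr (_ - _)%E; apply: ge0_eq_integral_orthant => //.
- exact: measurable_funepos.
- exact: measurable_funepos.
- by move=> r r0; rewrite !funeposE fg.
- exact: measurable_funeneg.
- exact: measurable_funeneg.
- by move=> r r0; rewrite !funenegE fg.
Qed.

Lemma integrable_half_expR (k : R) : 0 < k ->
  half_lebesgue.-integrable setT (EFin \o (fun r : R => expR (- (k * r)))).
Proof.
move=> k0.
have de := is_derive_expRN k.
have ce := is_derive_continuous de.
have me : measurable_fun setT (fun r : R => expR (- (k * r))).
  exact: continuous_measurable_fun.
apply: (integrable_half_le me me) => [x _|]; first by rewrite ger0_norm ?expR_ge0.
have dF (s : R) : is_derive s 1 (fun s => - k^-1 * expR (- (k * s))) (expR (-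
    (k * s))).
  apply: (is_derive_eq (is_derive_mulc (- k^-1) (de s))).
  by field; rewrite gt_eqF.
rewrite (ge0_integral_half_FTC (fun x _ => expR_ge0 _) dF ce (l := 0)) ?ltry//.
by rewrite -(mulr0 (- k^-1)); apply: cvgMr; exact: expR_linear_cvg0.
Qed.

Lemma integrable_orthant_expR n (gam : 'I_n -> R) : (forall k, 0 < gam k) ->
  (orth n).-integrable setT
    (EFin \o (fun r : tup n => expR (- \sum_k gam k * tnth r k))).
Proof.
move=> gam0.
have := @integrable_prod_tnth _ _ R half_lebesgue n
  (fun k r => expR (- (gam k * r))) (fun _ _ => expR_ge0 _)
  (fun k => integrable_half_expR (gam0 k)).
apply: eq_integrable => // r _ /=.
by rewrite -expR_sum sumrN.
Qed.

(** This is omega_FTC integrated over the orthant, with the two integrations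
    exchanged. The integrand is nonnegative only when r is in the orthant, so
    Tonelli's theorem is applied to its absolute value. *)
Lemma orthant_omega n (b S : tup n -> R) (A a : R) :
  measurable_fun setT b -> measurable_fun setT S -> 0 < A -> 0 < a ->
  (forall r : tup n, (forall k, 0 <= (tnth r k : R)) -> 0 <= b r /\ 0 <= S r) ->
  (\int[orth n]_r (expR (- (pi * (a * A + 2 * Num.sqrt a * b r + S r))))%:E =
   \int[@lebesgue_measure R]_(w in `[a, +oo[) \int[orth n]_r
     (pi * (A + b r / Num.sqrt w) *
      expR (- (pi * (w * A + 2 * Num.sqrt w * b r + S r))))%:E)%E.
Proof.
move=> mb mS A0 a0 bS0.
pose phi (p : measurableTypeR R * tup n) : R := pi * (A + b p.2 / Num.sqrt p.1) *
  expR (- (pi * (p.1 * A + 2 * Num.sqrt p.1 * b p.2 + S p.2))).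
have msqrt : measurable_fun setT (@Num.sqrt R).
  by apply: continuous_measurable_fun; exact: sqrt_continuous.
have mb2 : measurable_fun setT (fun p : measurableTypeR R * tup n => b p.2).
  exact: (measurableT_comp mb measurable_snd).
have mS2 : measurable_fun setT (fun p : measurableTypeR R * tup n => S p.2).
  exact: (measurableT_comp mS measurable_snd).
have ms1 : measurable_fun setT (fun p : measurableTypeR R * tup n => Num.sqrt
    (p.1 : R)).
  exact: (measurableT_comp msqrt measurable_fst).
have mphi : measurable_fun setT phi.
  apply: measurable_funM.
    apply: measurable_funM; first exact: measurable_cst.
    apply: measurable_funD; first exact: measurable_cst.
    apply: measurable_funM => //.
    exact: (measurableT_comp measurable_invsqrt measurable_fst).
  apply: measurableT_comp => //; apply: measurableT_comp; first exact:
      oppr_measurable.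
  apply: measurable_funM; first exact: measurable_cst.
  apply: measurable_funD => //; apply: measurable_funD.
    by apply: measurable_funM; [exact: measurable_fst|exact: measurable_cst].
  apply: measurable_funM => //; apply: measurable_funM => //.
pose D : set (measurableTypeR R) := `[a, +oo[%classic.
have mD : measurable D by exact: measurable_itv.
pose psi (p : measurableTypeR R * tup n) : \bar R := (\1_D p.1 * `|phi p|)%:E.
have mpsi : measurable_fun setT psi.
  apply/measurable_EFinP; apply: measurable_funM.
    apply: (measurableT_comp _ measurable_fst).
    exact: measurable_indic.
  exact: measurableT_comp.
have psi0 p : (0 <= psi p)%E by rewrite lee_fin mulr_ge0.
have psiE r : (\int[@lebesgue_measure R]_w psi (w, r) =
   \int[@lebesgue_measure R]_(w in D) `|phi (w, r)|%:E)%E.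
  rewrite [RHS]integral_mkcond; apply: eq_integral => w _.
  by rewrite /psi patchE indicE; case: ifPn => ? /=; rewrite ?mul1r ?mul0r.
have phi0 w r : (forall k, 0 <= (tnth r k : R)) -> a <= w -> 0 <= phi (w, r).
  move=> /bS0[b0 S0] aw.
  rewrite /phi /= mulr_ge0 ?expR_ge0// mulr_ge0 ?pi_ge0// addr_ge0 ?(ltW A0)//.
  by rewrite divr_ge0 ?sqrtr_ge0.
transitivity (\int[orth n]_r \int[@lebesgue_measure R]_w psi (w, r))%E.
  apply: eq_integral_orthant.
  - apply/measurable_EFinP; apply: measurableT_comp => //.
    apply: measurableT_comp; first exact: oppr_measurable.
    apply: measurable_funM; first exact: measurable_cst.
    apply: measurable_funD => //; apply: measurable_funD; first exact:
        measurable_cst.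
    by apply: measurable_funM.
  - exact: (measurable_fun_fubini_tonelli_G psi).
  - move=> r r0; have [b0 S0] := bS0 r r0.
    rewrite psiE -omega_FTC//; apply: eq_integral => w.
    rewrite inE/= in_itv/= andbT => aw.
    by rewrite ger0_norm ?phi0.
rewrite -(sfinite_Fubini lebesgue_measure (orth n) psi)//.
rewrite [RHS]integral_mkcond; apply: eq_integral => w _.
rewrite patchE; case: ifPn => [|wD]; last first.
  by rewrite integral0_eq// => r _; rewrite /psi indicE (negbTE wD) mul0r.
move=> wD; have aw : a <= w by move: (wD); rewrite inE /D /= in_itv/= andbT.
have mphiw : measurable_fun setT (fun r => phi (w, r)).
  apply: (measurableT_comp mphi).
  by apply: measurable_fun_pair; [exact: measurable_cst|exact: measurable_id].
apply: eq_integral_orthant.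
- apply: (measurableT_comp mpsi).
  by apply: measurable_fun_pair; [exact: measurable_cst|exact: measurable_id].
- exact/measurable_EFinP.
- by move=> r r0; rewrite /psi indicE wD mul1r ger0_norm ?phi0.
Qed.

End orthant.

(** * Gaussian integrals over cones *)

Section bilinear_form.
Context {K : comPzRingType} {N : nat} (G : 'M[K]_N).
Implicit Types (u v w : 'rV[K]_N) (a : K).
Local Notation B := (bform G).

Lemma bformDl u v w : B (u + v) w = B u w + B v w.
Proof. by rewrite /bform !mulmxDl mxE. Qed.

Lemma bformDr u v w : B u (v + w) = B u v + B u w.
Proof. by rewrite /bform linearD mulmxDr mxE. Qed.

Lemma bformZl a u v : B (a *: u) v = a * B u v.
Proof. by rewrite /bform -!scalemxAl mxE. Qed.

Lemma bformZr a u v : B u (a *: v) = a * B u v.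
Proof. by rewrite /bform linearZ /= -scalemxAr mxE. Qed.

Lemma bform0l u : B 0 u = 0.
Proof. by rewrite /bform !mul0mx mxE. Qed.

Lemma bform0r u : B u 0 = 0.
Proof. by rewrite /bform trmx0 mulmx0 mxE. Qed.

Lemma bformBl u v w : B (u - v) w = B u w - B v w.
Proof. by rewrite bformDl -scaleN1r bformZl mulN1r. Qed.

Lemma bformBr u v w : B u (v - w) = B u v - B u w.
Proof. by rewrite bformDr -scaleN1r bformZr mulN1r. Qed.

Lemma bform_suml (I : Type) (s : seq I) (P : pred I) (F : I -> 'rV[K]_N) v :
  B (\sum_(i <- s | P i) F i) v = \sum_(i <- s | P i) B (F i) v.
Proof. by elim/big_rec2: _ => [|i x y _ <-]; rewrite ?bform0l// bformDl. Qed.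

Lemma bform_sumr (I : Type) (s : seq I) (P : pred I) (F : I -> 'rV[K]_N) v :
  B v (\sum_(i <- s | P i) F i) = \sum_(i <- s | P i) B v (F i).
Proof. by elim/big_rec2: _ => [|i x y _ <-]; rewrite ?bform0r// bformDr. Qed.

Hypothesis Gsym : G^T = G.

Lemma bformC u v : B u v = B v u.
Proof.
have -> : B u v = (u *m G *m v^T)^T 0 0 by rewrite [RHS]mxE.
by rewrite !trmx_mul trmxK Gsym mulmxA.
Qed.

Lemma qformD u v : qform G (u + v) = qform G u + 2 * B u v + qform G v.
Proof. by rewrite /qform !(bformDl, bformDr) (bformC v u); ring. Qed.

Lemma qformZ a u : qform G (a *: u) = a ^+ 2 * qform G u.
Proof. by rewrite /qform bformZl bformZr mulrA. Qed.

End bilinear_form.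

Lemma row_row' {K : Type} {m n : nat} (A : 'M[K]_(m.+1, n)) l k :
  row k (row' l A) = row (lift l k) A.
Proof. by apply/rowP => j; rewrite !mxE. Qed.

Section cone_integral.
Context {R : realType} {N : nat} (G : 'M[R]_N).
Hypothesis Gpd : posdef_gram G.
Local Notation B := (bform G).
Local Notation Q := (qform G).
Local Notation tup n := (n.-tuple (measurableTypeR R)).
Local Notation orth n := (power_measure n (@half_lebesgue R)).

Let Gsym : G^T = G. Proof. by case: Gpd. Qed.

Lemma qform_ge0 u : 0 <= Q u.
Proof.
have [->|u0] := eqVneq u 0; first by rewrite /qform bform0l.
by case: Gpd => _ /(_ _ u0)/ltW.
Qed.

Lemma qform_gt0 u : u != 0 -> 0 < Q u.
Proof. by case: Gpd => _; apply. Qed.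

Definition cone_vec {P} (D : 'M[R]_(P, N)) (r : tup P) : 'rV[R]_N :=
  \sum_k (tnth r k : R) *: row k D.

Definition cone_fun {P} (D : 'M[R]_(P, N)) (y : 'rV[R]_N) (r : tup P) : R :=
  expR (- (pi * Q (y + cone_vec D r))).

(** The Gaussian mass of the cone with apex y whose edges are the rows of D,
    with respect to the coordinates of these edges instead of the Euclidean
    volume. *)
Definition cone_int {P} (D : 'M[R]_(P, N)) (y : 'rV[R]_N) : R :=
  \int[orth P]_r cone_fun D y r.

Lemma measurable_bform_cone P (D : 'M[R]_(P, N)) u :
  measurable_fun setT (fun r : tup P => B u (cone_vec D r)).
Proof.
under eq_fun do rewrite bform_sumr.
apply: measurable_sum => k; under eq_fun do rewrite bformZr.
by apply: measurable_funM; [exact: measurable_tnth|exact: measurable_cst].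
Qed.

Lemma measurable_qform_cone P (D : 'M[R]_(P, N)) :
  measurable_fun setT (fun r : tup P => Q (cone_vec D r)).
Proof.
rewrite /qform; under eq_fun do rewrite {1}/cone_vec bform_suml.
apply: measurable_sum => k; under eq_fun do rewrite bformZl.
by apply: measurable_funM; [exact: measurable_tnth|exact: measurable_bform_cone].
Qed.

Lemma measurable_cone_fun P (D : 'M[R]_(P, N)) y :
  measurable_fun setT (cone_fun D y).
Proof.
rewrite /cone_fun; apply: measurableT_comp => //.
apply: measurableT_comp; first exact: oppr_measurable.
apply: measurable_funM; first exact: measurable_cst.
under eq_fun do rewrite qformD//.
apply: measurable_funD; last exact: measurable_qform_cone.
apply: measurable_funD; first exact: measurable_cst.
apply: measurable_funM; [exact: measurable_cst|exact: measurable_bform_cone].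
Qed.

(** The terms Q(y) and Q(cone_vec D r) are nonnegative; the linear term that
    remains already makes the Gaussian integrable over the orthant. *)
Lemma qform_cone_ge P (D : 'M[R]_(P, N)) y (r : tup P) :
  2 * \sum_k B (row k D) y * tnth r k <= Q (y + cone_vec D r).
Proof.
rewrite qformD// addrAC -[leLHS]add0r lerD//; last first.
  rewrite bform_sumr le_eqVlt; apply/orP; left; apply/eqP; congr (_ * _).
  by apply: eq_bigr => k _; rewrite bformZr mulrC (bformC Gsym).
by rewrite addr_ge0 ?qform_ge0.
Qed.

Lemma normr_bform_le u v : `|B u v| <= Q u + Q v.
Proof.
rewrite ler_norml; apply/andP; split.
  have := qform_ge0 (u + v); rewrite qformD//.
  by have := qform_ge0 u; have := qform_ge0 v; lra.
have := qform_ge0 (u - v); rewrite /qform !(bformBl, bformBr) (bformC Gsym v u).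
by have := qform_ge0 u; have := qform_ge0 v; rewrite /qform; lra.
Qed.

Section integrability.
Context {P : nat} (D : 'M[R]_(P, N)) (y : 'rV[R]_N).
Hypothesis Dy : forall k, 0 < B (row k D) y.

Lemma integrable_cone_fun : (orth P).-integrable setT (EFin \o cone_fun D y).
Proof.
have gam0 k : 0 < 2 * pi * B (row k D) y by rewrite !mulr_gt0 ?pi_gt0.
apply: dominated_integrable (integrable_orthant_expR gam0).
  exact: measurable_cone_fun.
move=> r; rewrite /cone_fun ger0_norm ?expR_ge0// ler_expR lerN2.
rewrite (le_trans _ (ler_wpM2l (pi_ge0 R) (qform_cone_ge D y r)))//.
rewrite le_eqVlt; apply/orP; left; apply/eqP.
by rewrite !mulr_sumr; apply: eq_bigr => k _; ring.
Qed.

(** The linear factor is at most a multiple of 1 + Q <= e^Q, which the decay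
    e^(- pi Q) absorbs. *)
Lemma integrable_bform_cone_fun u : (orth P).-integrable setT
  (EFin \o (fun r => B u (y + cone_vec D r) * cone_fun D y r)).
Proof.
have gam0 k : 0 < 1 * B (row k D) y by rewrite !mulr_gt0.
have := integrableZl measurableT (Q u + 1) (integrable_orthant_expR gam0).
rewrite /comp; under eq_fun do rewrite -EFinM; apply: dominated_integrable.
  apply: measurable_funM; last exact: measurable_cone_fun.
  under eq_fun do rewrite bformDr.
  by apply: measurable_funD; [exact: measurable_cst|exact: measurable_bform_cone].
move=> r; rewrite normrM (ger0_norm (expR_ge0 _)).
set w := y + cone_vec D r.
have h1 : `|B u w| <= (Q u + 1) * expR (Q w).
  apply: (le_trans (normr_bform_le u w)).
  have := expR_ge1Dx (Q w); have := qform_ge0 u; have := qform_ge0 w.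
  move: (Q u) (Q w) (expR _) => a b c *; nra.
apply: (le_trans (ler_wpM2r (expR_ge0 _) h1)).
rewrite -mulrA ler_wpM2l ?addr_ge0 ?qform_ge0// -expRD ler_expR.
have h2 := qform_cone_ge D y r; rewrite -/w in h2.
have := @pi_ge2 R; have := qform_ge0 w.
under eq_bigr do rewrite mul1r.
move: (\sum_k _) (Q w) (pi : R) h2 => a b c *; nra.
Qed.

End integrability.

Lemma cone_vec_tins P (D : 'M[R]_(P.+1, N)) l s (r : tup P) :
  cone_vec D (tins l (s, r)) = s *: row l D + cone_vec (row' l D) r.
Proof.
rewrite /cone_vec (bigD1_ord l)//= tnth_tins_eq; congr (_ + _).
by apply: eq_bigr => k _; rewrite tnth_tins_lift row_row'.
Qed.

(** The integrand is the derivative of - e^(- pi Q) along the l-th edge, so that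
    the integral over the l-th coordinate leaves the value at r_l = 0. *)
Lemma cone_face P (D : 'M[R]_(P.+1, N)) y l :
  (forall k, 0 < B (row k D) y) ->
  (\int[orth P.+1]_r
     (2 * pi * (B (row l D) (y + cone_vec D r) * cone_fun D y r))%:E =
   (cone_int (row' l D) y)%:E)%E.
Proof.
move=> Dy.
have iD := integrable_bform_cone_fun Dy (row l D).
have := integrableZl measurableT (2 * pi) iD.
rewrite /comp; under eq_fun do rewrite -EFinM; move=> i2.
rewrite (integral_power_ins _ l); last exact: measurable_int i2.
rewrite -integral21_prod_meas1; last exact: (integrable_power_ins l i2).
have Dy' k : 0 < B (row k (row' l D)) y by rewrite row_row'.
rewrite /cone_int -(integrable_integral (integrable_cone_fun Dy')).
apply: eq_integral => r _; rewrite /fubini_G /cone_fun.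
have q0 : 0 < Q (row l D).
  apply: qform_gt0; apply/eqP => D0.
  by have := Dy l; rewrite D0 bform0l ltxx.
rewrite -(half_gauss_FTC (B (row l D) (y + cone_vec (row' l D) r)) _ q0).
apply: eq_integral => s _; rewrite cone_vec_tins addrCA mulrA.
rewrite (bformDr G _ (s *: _)) bformZr -/(Q _) qformD// qformZ// bformZl.
by congr (_ * _ * expR (- (pi * _)))%:E; ring.
Qed.

(** The derivative of the mass when the apex moves along x is a flux through
    the faces: the derivative of the Gaussian along x is the combination, with
    coefficients h_l, of its derivatives along the edges, and each of these
    integrates to the mass of a face by cone_face. *)
Lemma cone_recursion P (D : 'M[R]_(P.+1, N)) x (h : 'I_P.+1 -> R) a :
  x = \sum_k h k *: row k D -> (forall k, 0 < B (row k D) x) -> 0 < a ->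
  ((cone_int D (Num.sqrt a *: x))%:E =
   \int[@lebesgue_measure R]_(w in `[a, +oo[)
     (\sum_l h l / (2 * Num.sqrt w) * cone_int (row' l D) (Num.sqrt w *: x))%:E)%E.
Proof.
move=> xE Dx a0.
have Dxw w k : 0 < w -> 0 < B (row k D) (Num.sqrt w *: x).
  by move=> w0; rewrite bformZr mulr_gt0 ?sqrtr_gt0.
have x0 : x != 0.
  by apply/eqP => x0; have := Dx ord0; rewrite x0 bform0r ltxx.
have QE w (r : tup P.+1) : 0 < w -> Q (Num.sqrt w *: x + cone_vec D r) =
    w * Q x + 2 * Num.sqrt w * B x (cone_vec D r) + Q (cone_vec D r).
  by move=> w0; rewrite qformD// qformZ// bformZl sqr_sqrtr ?ltW// mulrA.
rewrite /cone_int -(integrable_integral (integrable_cone_fun (fun k => Dxw a k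
    a0))).
rewrite /cone_fun; under eq_integral do rewrite QE//.
rewrite orthant_omega//; last 4 first.
- exact: measurable_bform_cone.
- exact: measurable_qform_cone.
- exact: qform_gt0.
- move=> r r0; split; last exact: qform_ge0.
  rewrite bform_sumr sumr_ge0// => k _.
  by rewrite bformZr mulr_ge0// (bformC Gsym) ltW.
apply: eq_integral => w; rewrite inE/= in_itv/= andbT => aw.
have w0 : 0 < w by exact: lt_le_trans aw.
have sw : Num.sqrt w != 0 by rewrite sqrtr_eq0 -ltNge.
transitivity (\int[orth P.+1]_r (\sum_l (h l / (2 * Num.sqrt w))%:E *
   (2 * pi * (B (row l D) (Num.sqrt w *: x + cone_vec D r) *
     cone_fun D (Num.sqrt w *: x) r))%:E))%E.
  apply: eq_integral => r _; rewrite /cone_fun QE//.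
  under eq_bigr do rewrite -EFinM.
  rewrite sumEFin; congr EFin.
  have -> : pi * (Q x + B x (cone_vec D r) / Num.sqrt w) =
     pi / Num.sqrt w * B x (Num.sqrt w *: x + cone_vec D r).
    by rewrite bformDr bformZr -/(Q x); field.
  rewrite {1}xE bform_suml mulr_sumr mulr_suml; apply: eq_bigr => l _.
  by rewrite bformZl; field.
have iD l : (orth P.+1).-integrable setT (fun r =>
   (2 * pi * (B (row l D) (Num.sqrt w *: x + cone_vec D r) *
     cone_fun D (Num.sqrt w *: x) r))%:E).
  under eq_fun do rewrite EFinM; apply: integrableZl => //.
  by apply: integrable_bform_cone_fun => k; exact: Dxw.
rewrite integral_sum//; last by move=> l; apply: integrableZl => //; exact: iD.
rewrite -sumEFin; apply: eq_bigr => l _.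
rewrite (integralZl _ (iD l))//.
by rewrite (@cone_face _ D (Num.sqrt w *: x) l (fun k => Dxw w k w0)) -EFinM.
Qed.

End cone_integral.

(** * Nested integrals over ordered variables *)

Section ordered_integral.
Context {R : realType}.
Local Notation mu := (@lebesgue_measure R).

Definition ordered_kernel (u w : R) : R := expR (- (pi * (w * u ^+ 2))) /
    Num.sqrt w.

(** The nested integral of iter_m with a free lower bound a, which is the
    parameter that the recursion on cones integrates over. *)
Fixpoint ordered_int n : ('I_n -> R) -> R -> R :=
  match n with
  | 0 => fun _ _ => 1
  | n'.+1 => fun u a => \int[mu]_(w in `[a, +oo[)
      (ordered_kernel (u ord0) w * ordered_int (fun j : 'I_n' => u (lift ord0 j)) w)
  end.

Lemma ordered_kernel_ge0 u w : 0 <= ordered_kernel u w.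
Proof. by rewrite mulr_ge0 ?expR_ge0 ?invr_ge0 ?sqrtr_ge0. Qed.

Lemma measurable_ordered_kernel u :
  measurable_fun setT (ordered_kernel u).
Proof.
apply: measurable_funM; last exact: measurable_invsqrt.
apply: measurableT_comp => //; apply: measurableT_comp; first exact:
    oppr_measurable.
apply: measurable_funM; first exact: measurable_cst.
by apply: measurable_funM; [exact: measurable_id|exact: measurable_cst].
Qed.

Lemma integrable_expR_tail (k a : R) : 0 < k -> 0 < a ->
  mu.-integrable `[a, +oo[ (EFin \o (fun w => expR (- (k * w)))).
Proof.
move=> k0 a0; have /integrableP[me eoo] := integrable_half_expR k0.
apply: (@integrableS _ _ _ mu `[0, +oo[) => //.
  by move=> x /=; rewrite !in_itv/= !andbT => /(le_trans (ltW a0)).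
apply/integrableP; split; first exact: measurable_funTS.
rewrite -integral_half_lebesgue//; exact: measurableT_comp.
Qed.

Definition nonincreasing_pos (f : R -> R) :=
  forall a b : R, 0 < a -> a <= b -> f b <= f a.

(** On the half-line f is measurable, being monotone, and bounded by f a; the
    decay comes from the Gaussian factor, and this is where u != 0 enters. *)
Lemma integrable_ordered_kernel (u a : R) (f : R -> R) : u != 0 -> 0 < a ->
  (forall w, 0 <= f w) -> nonincreasing_pos f ->
  mu.-integrable `[a, +oo[ (EFin \o (fun w => ordered_kernel u w * f w)).
Proof.
move=> u0 a0 f0 fni.
have k0 : 0 < pi * u ^+ 2 by rewrite mulr_gt0 ?pi_gt0// exprn_even_gt0.
have mfa : measurable_fun setT (fun w => f (Num.max a w)).
  apply: nonincreasing_measurable => // s t st; apply: fni.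
    by rewrite lt_max a0.
  by rewrite ge_max !le_max lexx /= st orbT.
have fE w : w \in `[a, +oo[ -> f w = f (Num.max a w).
  by rewrite in_itv/= andbT => /max_idPr ->.
have aC : mu.-integrable `[a, +oo[ (fun w => (((Num.sqrt a)^-1 * f a)%:E *
    (expR (- (pi * u ^+ 2 * w)))%:E)%E).
  by apply: integrableZl => //; exact: integrable_expR_tail.
apply: le_integrable aC => //.
  apply: (@eq_measurable_fun _ _ _ _ _ (EFin \o (fun w => ordered_kernel u w *
      f (Num.max a w)))).
    by move=> w; rewrite inE/= => wa; rewrite -fE.
  apply/measurable_EFinP; apply: measurable_funTS; apply: measurable_funM => //.
  exact: measurable_ordered_kernel.
move=> w /=; rewrite in_itv/= andbT => aw; have w0 := lt_le_trans a0 aw.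
rewrite lee_fin !ger0_norm ?mulr_ge0 ?ordered_kernel_ge0 ?expR_ge0 ?invr_ge0
    ?sqrtr_ge0//.
rewrite /ordered_kernel -mulrA mulrC.
have -> : pi * u ^+ 2 * w = pi * (w * u ^+ 2) by ring.
rewrite ler_wpM2r ?expR_ge0// ler_pM ?invr_ge0 ?sqrtr_ge0//; last exact: fni.
by rewrite lef_pV2 ?posrE ?sqrtr_gt0// ler_wsqrtr.
Qed.

Lemma ordered_int_props n (u : 'I_n -> R) : (forall j, u j != 0) ->
  (forall w, 0 <= ordered_int u w) /\ nonincreasing_pos (ordered_int u).
Proof.
elim: n u => [|n IH] u u0 /=; first by split=> // a b; rewrite lexx.
have [f0 fni] := IH (fun j => u (lift ord0 j)) (fun j => u0 _).
split=> [w|a b a0 ab].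
  by apply: Rintegral_ge0 => t _; rewrite mulr_ge0 ?ordered_kernel_ge0.
have b0 := lt_le_trans a0 ab.
have ia := integrable_ordered_kernel (u0 ord0) a0 f0 fni.
have ib := integrable_ordered_kernel (u0 ord0) b0 f0 fni.
apply: fine_le; [exact: integrable_fin_num ib|exact: integrable_fin_num ia|].
apply: ge0_subset_integral => //.
- exact: measurable_int ia.
- by move=> x _; rewrite lee_fin mulr_ge0 ?ordered_kernel_ge0.
- by move=> x /=; rewrite !in_itv/= !andbT; exact: le_trans.
Qed.

Lemma integrable_ordered_int n (u : 'I_n.+1 -> R) a : (forall j, u j != 0) -> 0
    < a ->
  mu.-integrable `[a, +oo[ (EFin \o (fun w =>
    ordered_kernel (u ord0) w * ordered_int (fun j => u (lift ord0 j)) w)).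
Proof.
move=> u0 a0; have [f0 fni] := ordered_int_props (fun j => u0 (lift ord0 j)).
exact: integrable_ordered_kernel.
Qed.

(** The constant K collects the factors of the outer variables when the
    induction enters an inner integral. *)
Lemma iter_integral_ordered n (u : 'I_n -> R) (a K : R) :
  (forall j, u j != 0) -> 0 < a ->
  iter_integral n a (fun w => K * (expR (- pi * \sum_(l < n) w`_l * u l ^+ 2) /
    Num.sqrt (\prod_(k < n) w`_k))) = K * ordered_int u a.
Proof.
elim: n u a K => [|n IH] u a K u0 a0 /=.
  by rewrite !big_ord0 mulr0 expR0 sqrtr1 divr1.
rewrite -RintegralZl//; last exact: integrable_ordered_int.
apply: eq_Rintegral => w; rewrite inE/= in_itv/= andbT => aw.
have w0 := lt_le_trans a0 aw.
rewrite mulrA -(IH _ w _ (fun j => u0 (lift ord0 j)) w0).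
congr (iter_integral n w); apply/funext => ws.
rewrite !big_ord_recl /= sqrtrM ?ltW// invfM mulrDr expRD /ordered_kernel.
by rewrite mulNr !mulrA; congr (_ * _); ring.
Qed.

Lemma iter_m_ordered n (u : 'I_n -> R) : (forall j, u j != 0) ->
  iter_m u = \prod_j (- u j) * ordered_int u 1.
Proof.
move=> u0; rewrite /iter_m -[ordered_int u 1]mul1r -iter_integral_ordered//.
by congr (_ * iter_integral _ _ _); apply/funext => ws; rewrite mul1r.
Qed.

End ordered_integral.

(** * Dual families and successive projections *)

Section biorthogonal.
Context {R : realType} {N : nat} (G : 'M[R]_N).
Hypothesis Gpd : posdef_gram G.
Local Notation B := (bform G).
Local Notation Q := (qform G).

Let Gsym : G^T = G. Proof. by case: Gpd. Qed.

(** This makes d the dual family of c: the second condition puts c in the span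
    of d. *)
Definition biorthogonal {P} (c d : 'M[R]_(P, N)) : Prop :=
  c *m G *m d^T = 1%:M /\ c = fam_gram G c *m d.

(** For biorthogonal families, the orthogonal projection to their common
    span. *)
Definition span_part {P} (c d : 'M[R]_(P, N)) (x : 'rV[R]_N) : 'rV[R]_N :=
  \sum_k B (row k c) x *: row k d.

Lemma biorthogonalP P (c d : 'M[R]_(P, N)) :
  (forall i j, B (row i c) (row j d) = (i == j)%:R) ->
  (forall i, row i c = span_part c d (row i c)) -> biorthogonal c d.
Proof.
move=> h1 h2; split.
  by apply/matrixP => i j; rewrite -bform_rows h1 mxE.
apply/row_matrixP => i; rewrite {1}h2 row_mul mulmx_sum_row.
by apply: eq_bigr => k _; rewrite !mxE (bformC Gsym).
Qed.

Section family.
Context {P : nat} (c d : 'M[R]_(P, N)).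
Hypothesis cd : biorthogonal c d.

Lemma bform_dual i j : B (row i c) (row j d) = (i == j)%:R.
Proof. by case: cd => h _; rewrite bform_rows h mxE. Qed.

Lemma row_span_part i : row i c = span_part c d (row i c).
Proof.
case: cd => _ h; rewrite {1}h row_mul mulmx_sum_row.
by apply: eq_bigr => k _; rewrite !mxE (bformC Gsym).
Qed.

Lemma fam_gram_mul : fam_gram G c *m fam_gram G d = 1%:M.
Proof.
case: cd => h1 h2; rewrite (fam_gramE G d) !mulmxA -h2 //.
Qed.

Lemma fam_gram_mulC : fam_gram G d *m fam_gram G c = 1%:M.
Proof. exact: mulmx1C fam_gram_mul. Qed.

Lemma dual_eq : d = fam_gram G d *m c.
Proof. by case: cd => _ h; rewrite {1}h mulmxA fam_gram_mulC mul1mx. Qed.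

Lemma row_dual_eq k : row k d = \sum_j B (row k d) (row j d) *: row j c.
Proof.
rewrite {1}dual_eq row_mul mulmx_sum_row.
by apply: eq_bigr => j _; rewrite !mxE.
Qed.

Lemma bform_dual_span_part k x : B (row k d) (span_part c d x) = B (row k d) x.
Proof.
rewrite bform_sumr [in RHS]row_dual_eq bform_suml; apply: eq_bigr => j _.
by rewrite bformZr bformZl mulrC.
Qed.

Lemma bform_span_part k x : B (row k c) (span_part c d x) = B (row k c) x.
Proof.
rewrite bform_sumr (bigD1 k)//= bformZr bform_dual eqxx mulr1 big1 ?addr0// => j jk.
by rewrite bformZr bform_dual eq_sym (negbTE jk) mulr0.
Qed.

Lemma qform_row_gt0 k : 0 < Q (row k c).
Proof.
apply: (qform_gt0 Gpd); apply/eqP => c0; have := bform_dual k k.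
by rewrite c0 bform0l eqxx => /eqP; rewrite eq_sym oner_eq0.
Qed.

End family.

Definition perp_fam {P} (c : 'M[R]_(P.+1, N)) (l : 'I_P.+1) : 'M[R]_(P, N) :=
  \matrix_k cperp G c [:: l] (lift l k).

Lemma row_perp_fam P (c : 'M[R]_(P.+1, N)) l k : row k (perp_fam c l) =
  row (lift l k) c - (B (row (lift l k) c) (row l c) / Q (row l c)) *: row l c.
Proof. by rewrite rowK. Qed.

Section removal.
Context {P : nat} (c d : 'M[R]_(P.+1, N)) (l : 'I_P.+1).
Hypothesis cd : biorthogonal c d.
Local Notation c' := (perp_fam c l).
Local Notation d' := (row' l d).

Let Ql : Q (row l c) != 0. Proof. by rewrite gt_eqF// (qform_row_gt0 cd). Qed.

Lemma bform_perp_fam k : B (row l c) (row k c') = 0.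
Proof.
rewrite row_perp_fam bformBr bformZr -/(Q _) (bformC Gsym) divfK//.
exact: subrr.
Qed.

(** The first term is the projection to the line of c_l, the second one the
    projection to the orthogonal complement of c_l in the span. *)
Lemma span_part_perp_fam x :
  span_part c d x = (B (row l c) x / Q (row l c)) *: row l c + span_part c' d' x.
Proof.
set g := B (row l c) x / Q (row l c).
have -> : g *: row l c = B (row l c) x *: row l d +
    \sum_k (g * B (row (lift l k) c) (row l c)) *: row (lift l k) d.
  rewrite [X in g *: X](row_span_part cd) /span_part (bigD1_ord l)//= scalerDr.
  rewrite scalerA divfK//; congr (_ + _).
  by rewrite scaler_sumr; apply: eq_bigr => k _; rewrite scalerA.
rewrite /span_part (bigD1_ord l)//= -addrA; congr (_ + _).
rewrite -big_split/=; apply: eq_bigr => k _.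
rewrite row_row' row_perp_fam bformBl bformZl -scalerDl; congr (_ *: _).
by rewrite /g; field.
Qed.

(** The dual vectors other than d_l are orthogonal to c_l, so that projecting
    the c_k away from c_l leaves them dual to the result. *)
Lemma biorthogonal_perp_fam : biorthogonal c' d'.
Proof.
apply: biorthogonalP => [i j|i].
  rewrite row_row' row_perp_fam bformBl bformZl !(bform_dual cd).
  by rewrite (negbTE (neq_lift l j)) mulr0 subr0 (inj_eq lift_inj).
have h u v a : span_part c d (u - a *: v) = span_part c d u - a *: span_part c d v.
  rewrite /span_part scaler_sumr -sumrB; apply: eq_bigr => k _.
  by rewrite bformBr bformZr scalerBl scalerA.
have := span_part_perp_fam (row i c').
rewrite bform_perp_fam mul0r scale0r add0r => <-.
by rewrite row_perp_fam h -!(row_span_part cd).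
Qed.

Lemma bform_row_span_part_perp x : B (row l c) (span_part c' d' x) = 0.
Proof.
rewrite bform_sumr big1// => k _.
by rewrite row_row' bformZr (bform_dual cd) (negbTE (neq_lift l k)) mulr0.
Qed.

(** Cramer's rule: the two Gram matrices are inverse to each other, so that
    Q(c_l) is a cofactor of the Gram matrix of d divided by its determinant. *)
Lemma det_fam_gram_row' :
  \det (fam_gram G d) * Q (row l c) = \det (fam_gram G d').
Proof.
have := mul_mx_adj (fam_gram G d).
move=> /(congr1 (fun M => (fam_gram G c *m M) l l)).
rewrite /= mulmxA (fam_gram_mul cd) mul1mx mul_mx_scalar.
have -> : fam_gram G d' = row' l (col' l (fam_gram G d)).
  by apply/matrixP => i j; rewrite !mxE !row_row'.
rewrite !mxE /cofactor -signr_odd oddD addbb expr0 mul1r => ->.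
by rewrite -/(Q _).
Qed.

End removal.

Lemma det_fam_gram_gt0 P (c d : 'M[R]_(P, N)) :
  biorthogonal c d -> 0 < \det (fam_gram G d).
Proof.
elim: P c d => [|P IH] c d cd; first by rewrite det_mx00.
have := IH _ _ (biorthogonal_perp_fam ord0 cd).
by rewrite -(det_fam_gram_row' ord0 cd) pmulr_lgt0// (qform_row_gt0 cd).
Qed.

(** In the list of cperp the last index is the one that is projected out
    first. *)
Lemma cperp_perp_fam P (c : 'M[R]_(P.+1, N)) l s n :
  cperp G c (rcons [seq lift l i | i <- s] l) (lift l n) =
  cperp G (perp_fam c l) s n.
Proof.
elim: s n => [|m s IH] n; first by rewrite /= rowK.
by rewrite /= !IH.
Qed.

Lemma vvar_perp_fam P (c : 'M[R]_(P.+1, N)) x l s : s != [::] ->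
  vvar G c x (l :: [seq lift l i | i <- s]) = vvar G (perp_fam c l) x s.
Proof.
rewrite /vvar rev_cons -map_rev => s0.
case: (rev s) (size_rev s) => [|n s'] /=.
  by move=> /esym/size0nil s0'; rewrite s0' in s0.
by rewrite cperp_perp_fam.
Qed.

Lemma vvar1 P (c : 'M[R]_(P, N)) x l :
  vvar G c x [:: l] = B (row l c) x / Num.sqrt (Q (row l c)).
Proof. by []. Qed.

Definition vvars_neq0 P (c : 'M[R]_(P, N)) (x : 'rV[R]_N) :=
  forall s : seq 'I_P, s != [::] -> uniq s -> vvar G c x s != 0.

Lemma vvars_neq0_perp_fam P (c : 'M[R]_(P.+1, N)) x l :
  vvars_neq0 c x -> vvars_neq0 (perp_fam c l) x.
Proof.
move=> h s s0 us; rewrite -vvar_perp_fam//; apply: h => //=.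
rewrite map_inj_uniq ?us ?andbT; last exact: lift_inj.
by apply/mapP => -[k _] /eqP; apply/negP; rewrite neq_lift.
Qed.

(** Once all the other vectors are projected out, c_n becomes a multiple of
    d_n, and the corresponding v variable is nonzero. *)
Lemma dual_bform_neq0 P (c d : 'M[R]_(P, N)) x :
  biorthogonal c d -> vvars_neq0 c x -> forall n, B (row n d) x != 0.
Proof.
elim: P c d => [|P IH] c d cd hx n; first by case: n.
case: P => [|P] in IH c d cd hx n *.
  have := hx [:: n] isT isT; rewrite vvar1; apply: contra_neq => b0.
  rewrite (row_span_part cd) /span_part (big_ord1 _ _) (ord1 n) in b0 *.
  by rewrite bformZl b0 mulr0 mul0r.
have [l ln] : exists l : 'I_P.+2, l != n.
  by exists (lift n ord0); rewrite eq_sym neq_lift.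
have [k ->] : exists k, n = lift l k.
  by have [k ->|nl] := unliftP l n; [exists k|rewrite nl eqxx in ln].
rewrite -row_row'; apply: (IH (perp_fam c l)).
  exact: biorthogonal_perp_fam.
exact: vvars_neq0_perp_fam.
Qed.

Definition flag_vvar P (c : 'M[R]_(P, N)) (x : 'rV[R]_N) (s : 'S_P) (l : 'I_P)
    : R :=
  vvar G c x (take l.+1 [seq s k | k <- enum 'I_P]).

Lemma flag_vvar_neq0 P (c : 'M[R]_(P, N)) x (s : 'S_P) :
  vvars_neq0 c x -> forall l, flag_vvar c x s l != 0.
Proof.
move=> h l; apply: h.
  rewrite -size_eq0 size_take size_map size_enum_ord.
  by case: ifP => // _; rewrite -lt0n (leq_ltn_trans _ (ltn_ord l)).
by apply: take_uniq; rewrite map_inj_uniq ?enum_uniq//; exact: perm_inj.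
Qed.

Lemma flag_vvar_lift_perm P (c : 'M[R]_(P.+1, N)) x l (s : 'S_P) :
  flag_vvar c x (lift_perm ord0 l s) ord0 = vvar G c x [:: l] /\
  (fun j => flag_vvar c x (lift_perm ord0 l s) (lift ord0 j)) =
    flag_vvar (perp_fam c l) x s.
Proof.
have E : [seq lift_perm ord0 l s k | k <- enum 'I_P.+1] =
    l :: [seq lift l i | i <- [seq s k | k <- enum 'I_P]].
  rewrite enum_ordSl /= lift_perm_id -!map_comp; congr (_ :: _).
  by apply: eq_map => k /=; rewrite lift_perm_lift.
rewrite /flag_vvar E /= take0; split=> //; apply/funext => j.
rewrite /bump /= add1n -map_take vvar_perp_fam//.
rewrite -size_eq0 size_take size_map size_enum_ord.
by case: ifP => // _; rewrite -lt0n (leq_ltn_trans _ (ltn_ord j)).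
Qed.

End biorthogonal.

(** The map (l, t) |-> lift_perm ord0 l t is injective, and the cardinals
    agree as (P + 1)! = (P + 1) P!. *)
Lemma big_perm_lift (V : nmodType) P (F : 'S_P.+1 -> V) :
  \sum_(s : 'S_P.+1) F s = \sum_l \sum_(t : 'S_P) F (lift_perm ord0 l t).
Proof.
rewrite pair_big/=.
pose h (p : 'I_P.+1 * 'S_P) := lift_perm ord0 p.1 p.2.
have hinj : injective h.
  move=> [l t] [l' t'] /permP e.
  have := e ord0; rewrite /h !lift_perm_id => /= ll'; subst l'.
  congr (_, _); apply/permP => k; have := e (lift ord0 k).
  by rewrite /h !lift_perm_lift => /lift_inj.
have hcard : (#|'S_P.+1| <= #|{: 'I_P.+1 * 'S_P}|)%N.
  by rewrite card_prod !card_Sn card_ord factS.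
by rewrite (reindex h)//; apply: onW_bij; exact: inj_card_bij hinj hcard.
Qed.

(** * The cone integral as a sum over orderings *)

Section orthant_mass.
Context {R : realType} {N : nat} (G : 'M[R]_N).
Hypothesis Gpd : posdef_gram G.
Local Notation B := (bform G).
Local Notation Q := (qform G).
Local Notation mu := (@lebesgue_measure R).

Let Gsym : G^T = G. Proof. by case: Gpd. Qed.

(** The signs give each dual vector a positive product with x; these are the
    edges of the cone. *)
Definition signed_dual {P} (d : 'M[R]_(P, N)) (x : 'rV[R]_N) : 'M[R]_(P, N) :=
  \matrix_k (Num.sg (B (row k d) x) *: row k d).

Lemma row_signed_dual P (d : 'M[R]_(P, N)) x k :
  row k (signed_dual d x) = Num.sg (B (row k d) x) *: row k d.
Proof. by rewrite rowK. Qed.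

Lemma row'_signed_dual P (d : 'M[R]_(P.+1, N)) x l :
  row' l (signed_dual d x) = signed_dual (row' l d) x.
Proof.
by apply/row_matrixP => k; rewrite row_row' !row_signed_dual row_row'.
Qed.

(** The real closed form of M_P at (sqrt a) x, see gen_erfc_orthant_mass. *)
Definition orthant_mass {P} (c d : 'M[R]_(P, N)) (x : 'rV[R]_N) (a : R) : R :=
  (\prod_k (- 2 * Num.sg (B (row k d) x))) * Num.sqrt (\det (fam_gram G d)) *
  cone_int G (signed_dual d x) (Num.sqrt a *: span_part G c d x).

Lemma bform_signed_dual_gt0 P (c d : 'M[R]_(P, N)) x w k :
  biorthogonal G c d -> vvars_neq0 G c x -> 0 < w ->
  0 < B (row k (signed_dual d x)) (Num.sqrt w *: span_part G c d x).
Proof.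
move=> cd hx w0; have b0 := dual_bform_neq0 Gpd cd hx k.
rewrite row_signed_dual bformZr mulr_gt0 ?sqrtr_gt0// bformZl.
by rewrite (bform_dual_span_part cd) -normrEsg normr_gt0.
Qed.

(** Pythagoras: the face without the l-th edge spans the orthogonal complement
    of c_l, and w v_l^2 is Q of the component of (sqrt w) x along c_l. *)
Lemma cone_int_perp P (c d : 'M[R]_(P.+1, N)) x l w :
  biorthogonal G c d -> vvars_neq0 G c x -> 0 < w ->
  cone_int G (row' l (signed_dual d x)) (Num.sqrt w *: span_part G c d x) =
  expR (- (pi * (w * vvar G c x [:: l] ^+ 2))) *
  cone_int G (signed_dual (row' l d) x)
    (Num.sqrt w *: span_part G (perp_fam G c l) (row' l d) x).
Proof.
move=> cd hx w0; rewrite row'_signed_dual.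
have cd' := biorthogonal_perp_fam Gpd l cd.
have hx' := vvars_neq0_perp_fam l hx.
have Ql := qform_row_gt0 Gpd cd l.
rewrite /cone_int -RintegralZl//; last first.
  by apply: integrable_cone_fun => // k; exact: (bform_signed_dual_gt0 _ cd' hx').
apply: eq_Rintegral => r _; rewrite /cone_fun -expRD -opprD -mulrDr.
congr (expR (- (pi * _))).
rewrite (span_part_perp_fam Gpd l cd) scalerDr -addrA qformD//.
rewrite [X in _ + 2 * X + _](_ : _ = 0); last first.
  rewrite !bformZl bformDr bformZr (bform_row_span_part_perp l cd) mulr0 add0r.
  rewrite bform_sumr big1 ?mulr0// => k _.
  rewrite bformZr row_signed_dual bformZr row_row' (bform_dual cd).
  by rewrite (negbTE (neq_lift l k)) !mulr0.
rewrite mulr0 addr0 !qformZ// sqr_sqrtr ?ltW// vvar1; congr (_ * _ + _).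
by rewrite !exprMn !exprVn sqr_sqrtr ?ltW//; field; rewrite gt_eqF.
Qed.

(** Both sides are integrals over w >= a: the left-hand side by
    cone_recursion, the right-hand side by splitting off the first index l of
    the ordering. The integrands agree by the induction hypothesis for the
    family projected away from c_l. *)
Theorem orthant_mass_flag_sum P (c d : 'M[R]_(P, N)) x a :
  biorthogonal G c d -> vvars_neq0 G c x -> 0 < a ->
  orthant_mass c d x a =
  \sum_(s : 'S_P) (\prod_l (- flag_vvar G c x s l)) * ordered_int (flag_vvar G
      c x s) a.
Proof.
elim: P c d a => [|P IH] c d a cd hx a0.
  rewrite /orthant_mass big_ord0 det_mx00 sqrtr1 !mul1r.
  under eq_bigr do rewrite big_ord0 /= mul1r.
  rewrite sumr_const cardT -cardE card_Sn fact0.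
  rewrite /cone_int /Rintegral integral_power0; last first.
    by apply/measurable_EFinP; exact: measurable_cone_fun.
  rewrite /cone_fun /span_part /cone_vec !big_ord0 scaler0 addr0 /qform bform0l.
  by rewrite mulr0 oppr0 expR0.
pose v l := vvar G c x [:: l].
have v0 l : v l != 0 by apply: hx.
have cd' l := biorthogonal_perp_fam Gpd l cd.
have hx' l := vvars_neq0_perp_fam l hx.
pose K := (\prod_k (- 2 * Num.sg (B (row k d) x))) * Num.sqrt (\det (fam_gram G d)).
have b0 := dual_bform_neq0 Gpd cd hx.
have sg2 l : Num.sg (B (row l d) x) ^+ 2 = 1 by rewrite sqr_sg b0.
have K0 : K != 0.
  rewrite mulf_neq0//; last first.
    by rewrite sqrtr_eq0 -ltNge; exact: (det_fam_gram_gt0 Gpd cd).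
  by apply/prodf_neq0 => k _; rewrite mulf_neq0 ?sgr_eq0 ?b0 ?oppr_eq0 ?pnatr_eq0.
(* the summand of the right-hand side attached to the first index l and the
   ordering t of the others *)
pose f l (t : 'S_P) w := - v l * (\prod_j (- flag_vvar G (perp_fam G c l) x t j)) *
  (ordered_kernel (v l) w * ordered_int (flag_vvar G (perp_fam G c l) x t) w).
have ker l (t : 'S_P) : mu.-integrable `[a, +oo[ (EFin \o (fun w =>
    ordered_kernel (v l) w * ordered_int (flag_vvar G (perp_fam G c l) x t) w)).
  have [f0 fni] := ordered_int_props (flag_vvar_neq0 t (hx' l)).
  exact: integrable_ordered_kernel.
have intf l t : mu.-integrable `[a, +oo[ (EFin \o f l t).
  by apply: integrable_scale => //; exact: ker.
have intF : mu.-integrable `[a, +oo[ (EFin \o (fun w => \sum_l \sum_t f l t w)).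
  by apply: integrable_bigsum => // l; exact: integrable_bigsum.
have rhsE : \sum_(s : 'S_P.+1) (\prod_l (- flag_vvar G c x s l)) *
    ordered_int (flag_vvar G c x s) a =
    \int[mu]_(w in `[a, +oo[) (\sum_l \sum_t f l t w).
  have ifl l : mu.-integrable `[a, +oo[ (EFin \o (fun w => \sum_t f l t w)).
    exact: integrable_bigsum.
  rewrite big_perm_lift Rintegral_bigsum//; apply: eq_bigr => l _.
  rewrite Rintegral_bigsum//; apply: eq_bigr => t _.
  have [e0 e1] := flag_vvar_lift_perm G c x l t.
  rewrite big_ord_recl e0 /= e1 e0.
  under eq_bigr do rewrite (congr1 (@^~ _) e1).
  by rewrite -RintegralZl//; exact: ker.
rewrite rhsE /orthant_mass -/K.
(* the constant K goes to the side whose integrability is known *)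
apply: (mulfI (invr_neq0 K0)); rewrite mulKf//.
rewrite -RintegralZl//.
pose h l := Num.sg (B (row l d) x) * B (row l c) x.
have xE : span_part G c d x = \sum_l h l *: row l (signed_dual d x).
  apply: eq_bigr => l _; rewrite row_signed_dual scalerA /h mulrAC -expr2 sg2.
  by rewrite mul1r.
have Dx l : 0 < B (row l (signed_dual d x)) (span_part G c d x).
  by have := bform_signed_dual_gt0 l cd hx (@ltr01 R); rewrite sqrtr1 scale1r.
apply: EFin_inj; rewrite (cone_recursion Gpd xE Dx a0).
rewrite [RHS]fineK; last first.
  by apply: integrable_fin_num => //; exact: integrable_scale.
apply: eq_integral => w; rewrite inE/= in_itv/= andbT => aw; congr EFin.
have w0 := lt_le_trans a0 aw.
rewrite mulr_sumr; apply: eq_bigr => l _.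
rewrite (cone_int_perp l cd hx w0) -/(v l).
have -> : \sum_t f l t w = - v l * ordered_kernel (v l) w *
    orthant_mass (perp_fam G c l) (row' l d) x w.
  rewrite (IH _ _ _ (cd' l) (hx' l) w0) mulr_sumr; apply: eq_bigr => t _.
  by rewrite /f; ring.
have KE : K * h l = - 2 * v l * ((\prod_k (- 2 * Num.sg (B (row k (row' l d)) x))) *
    Num.sqrt (\det (fam_gram G (row' l d)))).
  have Ql := qform_row_gt0 Gpd cd l.
  rewrite -(det_fam_gram_row' l cd) sqrtrM ?(ltW (det_fam_gram_gt0 Gpd cd))//.
  rewrite /K (bigD1_ord l)//= /h /v vvar1.
  under [in RHS]eq_bigr do rewrite row_row'.
  have sq0 : Num.sqrt (Q (row l c)) != 0 by rewrite sqrtr_eq0 -ltNge.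
  have := sg2 l.
  move: (Num.sg _) (\prod_k _) (Num.sqrt (\det _)) (Num.sqrt _) sq0 => s p q0 q
      nq s2.
  transitivity (s ^+ 2 * (- 2 * p * q0 * B (row l c) x)); first by ring.
  by rewrite s2; field.
apply: (mulfI K0); rewrite mulVKf//.
transitivity (K * h l / (2 * Num.sqrt w) * (expR (- (pi * (w * v l ^+ 2))) *
  cone_int G (signed_dual (row' l d) x)
    (Num.sqrt w *: span_part G (perp_fam G c l) (row' l d) x))); first by ring.
have sw : Num.sqrt w != 0 by rewrite sqrtr_eq0 -ltNge.
rewrite KE /orthant_mass /ordered_kernel.
by field.
Qed.

End orthant_mass.

(** * Complex integrands *)

Section complex_helpers.
Context {R : realType}.
Implicit Types (a b p q : R) (z : R[i]).

Lemma cexp_real a : cexp a%:C%C = (expR a)%:C%C.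
Proof. by rewrite /cexp /= cos0 sin0 mulr1 mulr0. Qed.

Lemma CintegralZl d (T : measurableType d) (mu : {measure set T -> \bar R})
    (f : T -> R[i]) z :
  mu.-integrable setT (EFin \o (fun t => complex.Re (f t))) ->
  mu.-integrable setT (EFin \o (fun t => complex.Im (f t))) ->
  Cintegral mu (fun t => z * f t) = z * Cintegral mu f.
Proof.
move=> iR iI; case: z => u v; rewrite /Cintegral.
have ReE t : complex.Re (Complex u v * f t) =
    u * complex.Re (f t) - v * complex.Im (f t) by case: (f t).
have ImE t : complex.Im (Complex u v * f t) =
    u * complex.Im (f t) + v * complex.Re (f t) by case: (f t).
under eq_Rintegral do rewrite ReE; under [X in Complex _ X]eq_Rintegral do
    rewrite ImE.
rewrite RintegralB//; last 2 first.
- exact: integrable_scale.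
- exact: integrable_scale.
rewrite RintegralD//; last 2 first.
- exact: integrable_scale.
- exact: integrable_scale.
by rewrite !RintegralZl.
Qed.

(** The rotation by i sgn b turns a - i b into |b| + i (sgn b) a, whose real
    part is positive, as the Laplace integral requires. *)
Lemma inv_complex_sg a b : b != 0 ->
  (Complex a (- b))^-1 = 'i%C * (Num.sg b)%:C%C *
    Complex (`|b| / (`|b| ^+ 2 + (Num.sg b * a) ^+ 2))
            (- ((Num.sg b * a) / (`|b| ^+ 2 + (Num.sg b * a) ^+ 2))).
Proof.
move=> b0; have sb : Num.sg b ^+ 2 = 1 by rewrite sqr_sg b0.
have N0 : a ^+ 2 + b ^+ 2 != 0.
  by rewrite gt_eqF// ltr_wpDl ?sqr_ge0// exprn_even_gt0.
have z0 : Complex a (- b) != 0 :> R[i].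
  by rewrite eq_complex /= negb_and oppr_eq0 b0 orbT.
apply: (mulfI z0); rewrite divff// exprMn sb mul1r real_normK ?num_real//.
rewrite [b ^+ 2 + _]addrC.
have nb : Num.sg b * `|b| = b by rewrite -numEsg.
move: (`|b|) (Num.sg b) nb sb => m s nb sb.
apply/eqP; rewrite eq_complex /=; apply/andP; split; apply/eqP; last first.
  transitivity (a * (s * m) / (a ^+ 2 + b ^+ 2) - b * a * s ^+ 2 / (a ^+ 2 + b
      ^+ 2)).
    by rewrite nb sb; field.
  by field.
transitivity (a * a * s ^+ 2 / (a ^+ 2 + b ^+ 2) + b * (s * m) / (a ^+ 2 + b ^+ 2)).
  by rewrite nb sb; field.
by field.
Qed.

End complex_helpers.

(** * Laplace and Fourier transforms combined *)

Lemma integrable_laplace_weight {R : realType} (beta : R) : 0 < beta ->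
  half_lebesgue.-integrable setT (EFin \o laplace_weight beta).
Proof.
move=> beta0; apply: integrable_scale => //.
by apply: integrable_half_expR; rewrite !mulr_gt0 ?pi_gt0.
Qed.

Section laplace_gauss.
Context {R : realType} {N P : nat} (G : 'M[R]_N).
Hypothesis Gpd : posdef_gram G.
Local Notation B := (bform G).
Local Notation Q := (qform G).
Local Notation tup n := (n.-tuple (measurableTypeR R)).
Local Notation orth n := (power_measure n (@half_lebesgue R)).

Let Gsym : G^T = G. Proof. by case: Gpd. Qed.

Lemma bform_cone_vec D u (t : tup P) :
  B u (@cone_vec R N P D t) = \sum_j B u (row j D) * tnth t j.
Proof. by rewrite bform_sumr; apply: eq_bigr => j _; rewrite bformZr mulrC. Qed.

Lemma qform_onb (c e : 'M[R]_(P, N)) u : orthonormal_basis G c e -> (u <= c)%MS ->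
  Q u = \sum_j B u (row j e) ^+ 2.
Proof.
move=> [eo /andP[_ ce]] uc.
have /submxP[v ->] := submx_trans uc ce.
have be j : B (v *m e) (row j e) = v 0 j.
  rewrite mulmx_sum_row bform_suml (bigD1 j)//= bformZl eo eqxx mulr1.
  by rewrite big1 ?addr0// => k kj; rewrite bformZl eo (negbTE kj) mulr0.
rewrite /qform {2}mulmx_sum_row bform_sumr; apply: eq_bigr => j _.
by rewrite bformZr be expr2.
Qed.

Lemma qform_onb_coord (c e : 'M[R]_(P, N)) (t : tup P) : orthonormal_basis G c e ->
  Q (cone_vec e t) = \sum_j (tnth t j : R) ^+ 2.
Proof.
move=> [eo _]; rewrite /qform bform_sumr; apply: eq_bigr => j _.
rewrite bformZr (bformC Gsym) bform_cone_vec (bigD1 j)//= eo eqxx mul1r expr2.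
by rewrite big1 ?addr0// => k kj; rewrite eo eq_sym (negbTE kj) mul0r.
Qed.

Variables (c e D : 'M[R]_(P, N)) (y : 'rV[R]_N).
Hypothesis eonb : orthonormal_basis G c e.
Hypothesis Dc : (D <= c)%MS.
Hypothesis Dy : forall l, 0 < B (row l D) y.

Let beta l := B (row l D) y.

(** The complex number 1 / (beta_l + i a). *)
Definition laplace_factor (l : 'I_P) (t : tup P) : R[i] :=
  let a := B (row l D) (cone_vec e t) in
  Complex (beta l / (beta l ^+ 2 + a ^+ 2)) (- (a / (beta l ^+ 2 + a ^+ 2))).

Let W (r : tup P) := \prod_l laplace_weight (beta l) (tnth r l).
Let E (t : tup P) := \prod_j gauss_weight (tnth t j : R).

Let trig p q (x : R) := p * cos x + q * sin x.
Let phase (t r : tup P) : R :=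
  \sum_l 2 * pi * B (row l D) (cone_vec e t) * tnth r l.

(** The same phase drives the Laplace integral, as a sum over the coordinates
    of r, and the Fourier integral, as a sum over the coordinates of t. *)
Let phaseE t r : phase t r = \sum_j 2 * pi * B (row j e) (cone_vec D r) * tnth t j.
Proof.
rewrite /phase.
transitivity (2 * pi * B (cone_vec D r) (cone_vec e t)).
  rewrite [in RHS]bform_suml mulr_sumr; apply: eq_bigr => l _.
  by rewrite bformZl; ring.
rewrite bform_cone_vec mulr_sumr; apply: eq_bigr => j _.
by rewrite (bformC Gsym (row j e)); ring.
Qed.

Let iW : (orth P).-integrable setT (EFin \o W).
Proof.
have := @integrable_prod_tnth _ _ _ half_lebesgue P
  (fun l => laplace_weight (beta l)) (fun l => laplace_weight_ge0 (beta l)).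
by apply => l; exact: (integrable_laplace_weight (Dy l)).
Qed.

Let iE : (lebesgue_tuple R P).-integrable setT (EFin \o E).
Proof.
apply: (@integrable_prod_tnth _ (measurableTypeR R) R (@lebesgue_measure R) P
  (fun _ => @gauss_weight R) (fun _ => @gauss_weight_ge0 R)) => _.
exact: integrable_gauss_weight.
Qed.

Let W_ge0 r : 0 <= W r.
Proof. by apply: prodr_ge0 => l _; exact: laplace_weight_ge0. Qed.
Let E_ge0 t : 0 <= E t.
Proof. by apply: prodr_ge0 => l _; exact: gauss_weight_ge0. Qed.

Let F p q (z : tup P * tup P) := E z.1 * W z.2 * trig p q (phase z.1 z.2).

Let iF p q : (lebesgue_tuple R P \x orth P)%E.-integrable setT (EFin \o F p q).
Proof.
have h := integrable_scale measurableT (`|p| + `|q|) (integrable_tensor iE iW).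
apply: dominated_integrable h.
  have /integrableP[/measurable_EFinP mE _] := iE.
  have /integrableP[/measurable_EFinP mW _] := iW.
  have mph : measurable_fun setT (fun z : tup P * tup P => phase z.1 z.2).
    apply: measurable_sum => l; apply: measurable_funM.
      apply: measurable_funM; first exact: measurable_cst.
      exact: (measurableT_comp (measurable_bform_cone G e (row l D))
          measurable_fst).
    exact: (measurableT_comp (measurable_tnth l) measurable_snd).
  apply: measurable_funM.
    apply: measurable_funM.
      exact: (measurableT_comp mE measurable_fst).
    exact: (measurableT_comp mW measurable_snd).
  by apply: measurable_funD; apply: measurable_funM => //;
    [exact: (measurableT_comp measurable_cos)|exact: (measurableT_comp
        measurable_sin)].
move=> z; rewrite normrM ger0_norm ?mulr_ge0// mulrC.
by rewrite ler_wpM2r ?mulr_ge0 ?normr_trig_le.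
Qed.

Let inner_r p q t : (\int[orth P]_r (F p q (t, r))%:E =
  (E t * complex.Re (Complex p q * \prod_l laplace_factor l t))%:E)%E.
Proof.
pose k l (r : measurableTypeR R) : R := 2 * pi * B (row l D) (cone_vec e t) * r.
have mk l : measurable_fun setT (k l).
  by apply: measurable_funM; [exact: measurable_cst|exact: measurable_id].
have lap l p' q' := @laplace_trig R (beta l) (B (row l D) (cone_vec e t)) (Dy
    l) p' q'.
have h := @integral_prod_trig _ _ R half_lebesgue P (fun l => laplace_weight
    (beta l)) k
  (fun l => beta l / (beta l ^+ 2 + B (row l D) (cone_vec e t) ^+ 2))
  (fun l => B (row l D) (cone_vec e t) / (beta l ^+ 2 + B (row l D) (cone_vec e
      t) ^+ 2))
  (fun l => laplace_weight_ge0 (beta l)) (fun l => integrable_laplace_weight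
      (Dy l)) mk.
have hC l : (\int[half_lebesgue]_r (laplace_weight (beta l) r * cos (k l r))%:E =
    (beta l / (beta l ^+ 2 + B (row l D) (cone_vec e t) ^+ 2))%:E)%E.
  have [_ e1] := lap l 1 0; rewrite mul1r mul0r addr0 in e1.
  by rewrite -e1; apply: eq_integral => r _; rewrite mul1r mul0r addr0.
have hS l : (\int[half_lebesgue]_r (laplace_weight (beta l) r * sin (k l r))%:E =
    (B (row l D) (cone_vec e t) /
      (beta l ^+ 2 + B (row l D) (cone_vec e t) ^+ 2))%:E)%E.
  have [_ e1] := lap l 0 1; rewrite mul1r mul0r add0r in e1.
  by rewrite -e1; apply: eq_integral => r _; rewrite mul1r mul0r add0r.
have hE := h hC hS (E t * p) (E t * q).
set Pi := \prod_l laplace_factor l t.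
transitivity (complex.Re (Complex (E t * p) (E t * q) * Pi))%:E; last first.
  by case: (Pi) => u v /=; congr EFin; ring.
rewrite -[RHS]hE; apply: eq_integral => r _; rewrite /F /= /trig /phase /W /k.
by congr EFin; ring.
Qed.

Let inner_t p q r : (\int[lebesgue_tuple R P]_t (F p q (t, r))%:E =
  (W r * p * expR (- (pi * Q (cone_vec D r))))%:E)%E.
Proof.
pose k j (t : measurableTypeR R) : R := 2 * pi * B (row j e) (cone_vec D r) * t.
have mk j : measurable_fun setT (k j).
  by apply: measurable_funM; [exact: measurable_cst|exact: measurable_id].
have h := @integral_prod_trig _ (measurableTypeR R) R (@lebesgue_measure R) P
  (fun _ => @gauss_weight R) k
  (fun j => expR (- (pi * B (row j e) (cone_vec D r) ^+ 2))) (fun j => 0)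
  (fun _ => @gauss_weight_ge0 R) (fun _ => @integrable_gauss_weight R) mk
  (fun j => integral_gauss_cos _) (fun j => integral_gauss_sin _)
  (W r * p) (W r * q).
have Dr : (cone_vec D r <= c)%MS.
  apply: submx_trans Dc; apply: summx_sub => l _.
  by apply: scalemx_sub; exact: row_sub.
transitivity (complex.Re (Complex (W r * p) (W r * q) *
   \prod_j Complex (expR (- (pi * B (row j e) (cone_vec D r) ^+ 2))) (-
       0)))%:E; last first.
  have -> : \prod_j Complex (expR (- (pi * B (row j e) (cone_vec D r) ^+ 2)))
      (- 0) =
      (expR (- (pi * Q (cone_vec D r))))%:C%C.
    rewrite (qform_onb eonb Dr) mulr_sumr -sumrN expR_sum rmorph_prod.
    by apply: eq_bigr => j _; rewrite oppr0 (bformC Gsym).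
  by rewrite /= mulr0 subr0.
rewrite -h; apply: eq_integral => t _; rewrite /F /= /trig phaseE /E /k.
by congr EFin; ring.
Qed.

Lemma integrable_laplace_gauss p q :
  (lebesgue_tuple R P).-integrable setT (EFin \o (fun t : tup P =>
     expR (- (pi * Q (cone_vec e t))) *
     complex.Re (Complex p q * \prod_l laplace_factor l t))).
Proof.
have := integrable_fubini_F (iF p q); apply: eq_integrable => // t _.
rewrite /fubini_F inner_r /= (qform_onb_coord _ eonb) mulr_sumr -sumrN expR_sum.
by [].
Qed.

(** Each Laplace factor is an integral over r_l >= 0; integrating over t first
    gives the Gaussian Fourier transform e^(- pi Q(z)) at the point z of the
    cone with coordinates r, and the Laplace weights e^(- 2 pi B(y, z)) complete
    it to e^(- pi Q(y + z)) up to the constant e^(pi Q(y)). *)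
Lemma integral_laplace_gauss p q :
  \int[lebesgue_tuple R P]_t (expR (- (pi * Q (cone_vec e t))) *
     complex.Re (Complex p q * \prod_l laplace_factor l t)) =
  p * (2 * pi) ^+ P * expR (pi * Q y) * cone_int G D y.
Proof.
apply: EFin_inj; rewrite -(integrable_integral (integrable_laplace_gauss p q)).
transitivity (\int[lebesgue_tuple R P]_t fubini_F (orth P) (EFin \o F p q) t)%E.
  apply: eq_integral => t _; rewrite /fubini_F inner_r (qform_onb_coord _ eonb).
  by rewrite mulr_sumr -sumrN expR_sum.
rewrite integral12_prod_meas1// -integral21_prod_meas1//.
have ic := integrable_cone_fun Gpd Dy.
rewrite EFinM -(integrable_integral ic) -(integralZl _ ic)//.
apply: eq_integral => r _; rewrite /fubini_G inner_t -EFinM; congr EFin.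
have -> : W r = (2 * pi) ^+ P * expR (- (pi * (2 * B y (cone_vec D r)))).
  rewrite /W big_split/= prodr_const card_ord -expR_sum; congr (_ * expR _).
  rewrite bform_sumr !mulr_sumr -sumrN; apply: eq_bigr => l _.
  by rewrite bformZr (bformC Gsym y) -/(beta l); ring.
rewrite /cone_fun qformD//.
have -> : - (pi * (Q y + 2 * B y (cone_vec D r) + Q (cone_vec D r))) =
  - (pi * Q y) + (- (pi * (2 * B y (cone_vec D r))) - pi * Q (cone_vec D r)) by
      ring.
rewrite !expRD.
have := expRxMexpNx_1 (pi * Q y).
set e1 := expR (pi * Q y); set e2 := expR (- (pi * Q y)) => e12.
set e3 := expR _; set e4 := expR _.
by transitivity (p * (2 * pi) ^+ P * (e1 * e2) * e3 * e4); [rewrite e12|]; ring.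
Qed.

End laplace_gauss.

(** * From the contour integral to the cone integral *)

Section complex_form.
Context {R : realType} {N P : nat} (G : 'M[R]_N) (c e : 'M[R]_(P, N)) (x :
    'rV[R]_N).
Hypotheses (Gpd : posdef_gram G) (cfree : row_free c).
Hypothesis eonb : orthonormal_basis G c e.
Hypothesis hv : vvars_neq0 G c x.
Local Notation B := (bform G).
Local Notation Q := (qform G).
Local Notation d := (dual_fam G c).
Local Notation y := (span_part G c d x).
Local Notation D := (signed_dual G d x).

Let Gsym : G^T = G. Proof. by case: Gpd. Qed.

Lemma biorthogonal_dual_fam : biorthogonal G c d.
Proof.
have [_ h] := dual_famP Gpd cfree; split.
  by apply/matrixP => i j; rewrite -bform_rows h mxE.
by rewrite /dual_fam mulmxA mulmxV ?mul1mx// fam_gram_unit.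
Qed.

Let cd := biorthogonal_dual_fam.

Lemma proj_span_span_part : proj_span G c x = y.
Proof.
rewrite /proj_span /span_part.
transitivity (\sum_l \sum_k (B (row k c) x * B (row k d) (row l d)) *: row l c).
  apply: eq_bigr => l _; rewrite -scaler_suml; congr (_ *: _).
  rewrite -(bform_dual_span_part cd) /span_part bform_sumr.
  by apply: eq_bigr => k _; rewrite bformZr (bformC Gsym (row l d)).
rewrite exchange_big; apply: eq_bigr => k _; rewrite [X in _ *: X](row_dual_eq cd).
by rewrite scaler_sumr; apply: eq_bigr => l _; rewrite scalerA.
Qed.

Lemma bform_span_proj u : (u <= c)%MS -> B u x = B u y.
Proof.
move=> /submxP[v ->]; rewrite mulmx_sum_row !bform_suml; apply: eq_bigr => k _.
by rewrite !bformZl (bform_span_part cd).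
Qed.

Lemma bform_cplx (u v : 'rV[R]_N) :
  bform (cplx_mx G) (cplx_mx u) (cplx_mx v) = (B u v)%:C%C.
Proof. by rewrite /bform /cplx_mx map_trmx -!map_mxM mxE. Qed.

Let T (t : P.-tuple (measurableTypeR R)) : 'rV[R]_N := cone_vec e t.

Lemma contourE t : contour G c e x t = cplx_mx (T t) - ('i%C : R[i]) *: cplx_mx y.
Proof. by rewrite /contour proj_span_span_part. Qed.

Lemma bform_contour u t : bform (cplx_mx G) (cplx_mx u) (contour G c e x t) =
  Complex (B u (T t)) (- B u y).
Proof.
rewrite contourE bformBr bformZr !bform_cplx.
by apply/eqP; rewrite eq_complex /=; apply/andP; split; apply/eqP; ring.
Qed.

Let Tc t : (T t <= c)%MS.
Proof.
case: eonb => _ /andP[ec _]; apply: submx_trans ec.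
by apply: summx_sub => l _; apply: scalemx_sub; exact: row_sub.
Qed.

Let yc : (y <= c)%MS.
Proof.
rewrite -proj_span_span_part.
by apply: summx_sub => l _; apply: scalemx_sub; exact: row_sub.
Qed.

(** The imaginary parts cancel because x and its projection y have the same
    product with every vector of the span. *)
Lemma exponent_contour t :
  - (pi : R)%:C%C * qform (cplx_mx G) (contour G c e x t) -
  2 * (pi : R)%:C%C * 'i%C * bform (cplx_mx G) (contour G c e x t) (cplx_mx x) =
  (- (pi * Q (T t)) - pi * Q y)%:C%C.
Proof.
have -> : qform (cplx_mx G) (contour G c e x t) =
    Complex (Q (T t) - Q y) (- 2 * B (T t) y).
  rewrite /qform {1}contourE bformBl bformZl !bform_contour (bformC Gsym y (T t)).
  by apply/eqP; rewrite eq_complex /=; apply/andP; split; apply/eqP; ring.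
have -> : bform (cplx_mx G) (contour G c e x t) (cplx_mx x) =
    Complex (B (T t) y) (- Q y).
  rewrite contourE bformBl bformZl !bform_cplx !(bform_span_proj (Tc _)).
  rewrite (bform_span_proj yc) -/(Q y).
  by apply/eqP; rewrite eq_complex /=; apply/andP; split; apply/eqP; ring.
by apply/eqP; rewrite eq_complex /=; apply/andP; split; apply/eqP; ring.
Qed.

(** The factors i / pi of the prefactor, i eps_l of inv_complex_sg and 2 pi of
    integral_laplace_gauss multiply to - 2 eps_l for each l. *)
Theorem gen_erfc_orthant_mass : gen_erfc G c e x = (orthant_mass G c d x 1)%:C%C.
Proof.
have b0 := dual_bform_neq0 Gpd cd hv.
have Dy l : 0 < B (row l D) y.
  by have := bform_signed_dual_gt0 Gpd l cd hv (@ltr01 R); rewrite sqrtr1 scale1r.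
have Dc : (D <= c)%MS.
  apply/row_subP => l; rewrite row_signed_dual; apply: scalemx_sub.
  by apply: submx_trans (row_sub _ _) _; exact: submxMl.
pose sg l : R := Num.sg (B (row l d) x).
pose Z : R[i] := \prod_l ('i%C * (sg l)%:C%C).
pose h t : R[i] := (expR (- (pi * Q (T t))))%:C%C * \prod_l laplace_factor G e
    D y l t.
have factE l t : (bform (cplx_mx G) (cplx_mx (row l d)) (contour G c e x t))^-1 =
    'i%C * (sg l)%:C%C * laplace_factor G e D y l t.
  rewrite bform_contour (bform_dual_span_part cd) inv_complex_sg// /laplace_factor.
  have -> : B (row l D) y = `|B (row l d) x|.
    by rewrite row_signed_dual bformZl (bform_dual_span_part cd) -normrEsg.
  by rewrite row_signed_dual bformZl.
have ReE t : complex.Re (h t) = expR (- (pi * Q (T t))) *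
    complex.Re (Complex 1 0 * \prod_l laplace_factor G e D y l t).
  by rewrite /h; case: (\prod_l _) => u v /=; ring.
have ImE t : complex.Im (h t) = expR (- (pi * Q (T t))) *
    complex.Re (Complex 0 (-1) * \prod_l laplace_factor G e D y l t).
  by rewrite /h; case: (\prod_l _) => u v /=; ring.
rewrite /gen_erfc (_ : (fun t => _) =
    (fun t => (Z * (expR (- (pi * Q y)))%:C%C) * h t)); last first.
  apply/funext => t; rewrite exponent_contour cexp_real expRD.
  under eq_bigr do rewrite factE.
  by rewrite big_split/= rmorphM /h -/Z; ring.
rewrite CintegralZl; last 2 first.
- have := integrable_laplace_gauss Gpd eonb Dy 1 0.
  by apply: eq_integrable => // t _ /=; rewrite ReE.
- have := integrable_laplace_gauss Gpd eonb Dy 0 (-1).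
  by apply: eq_integrable => // t _ /=; rewrite ImE.
have -> : Cintegral (lebesgue_tuple R P) h =
    ((2 * pi) ^+ P * expR (pi * Q y) * cone_int G D y)%:C%C.
  rewrite /Cintegral; under eq_Rintegral do rewrite ReE.
  under [X in Complex _ X]eq_Rintegral do rewrite ImE.
  by rewrite !(integral_laplace_gauss Gpd eonb Dc Dy) mul1r !mul0r.
rewrite /orthant_mass sqrtr1 scale1r !rmorphM /=.
have pi0 : (pi : R)%:C%C != 0 by rewrite fmorph_eq0 gt_eqF// pi_gt0.
have e12 := expRxMexpNx_1 (pi * Q y).
have -> : (\prod_k (- 2 * Num.sg (B (row k d) x)))%:C%C =
    ('i%C / (pi : R)%:C%C) ^+ P * Z * ((2 * pi) ^+ P)%:C%C :> R[i].
  have cst (z : R[i]) : z ^+ P = \prod_(k < P) z by rewrite prodr_const card_ord.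
  rewrite rmorph_prod /Z rmorphXn /= !cst -!big_split/=.
  apply: eq_bigr => k _; rewrite !rmorphM/= rmorphN rmorph_nat -/(sg k).
  have i2 : 'i%C * 'i%C = -1 :> R[i] by rewrite -expr2 sqr_i.
  transitivity (('i%C * 'i%C) * 2 * (sg k)%:C%C * ((pi : R)%:C%C / (pi : R)%:C%C)).
    by rewrite i2 divff//; ring.
  by ring.
have e12C : (expR (pi * Q y))%:C%C * (expR (- (pi * Q y)))%:C%C = 1 :> R[i].
  by rewrite -rmorphM e12.
set A := (Num.sqrt _)%:C%C; set I := _ ^+ P; set J := (cone_int _ _ _)%:C%C.
set e1 := (expR (pi * Q y))%:C%C in e12C *; set e2 := (expR (- _))%:C%C in e12C *.
set pp := ((2 * pi) ^+ P)%:C%C.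
by transitivity (A * I * Z * pp * J * (e1 * e2)); [ring|rewrite e12C; ring].
Qed.

End complex_form.

(** * The expansion of the generalized complementary error function *)

Theorem theorem3p3 (R : realType) (N P : nat) (G : 'M[R]_N)
    (c e : 'M[R]_(P, N)) (x : 'rV[R]_N)
    (hG : posdef_gram G) (hP : (1 <= P <= N)%N) (hc : row_free c)
    (he : orthonormal_basis G c e)
    (hv : forall s : seq 'I_P, s != [::] -> uniq s -> vvar G c x s != 0) :
  gen_erfc G c e x =
  (\sum_(sigma : 'S_P)
     iter_m (fun l : 'I_P =>
       vvar G c x (take l.+1 [seq sigma k | k <- enum 'I_P])))%:C%C.
Proof.
rewrite (gen_erfc_orthant_mass hG hc he hv); congr _%:C%C.
rewrite (orthant_mass_flag_sum hG (biorthogonal_dual_fam hG hc) hv (@ltr01 R)).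
by apply: eq_bigr => s _; rewrite -iter_m_ordered//; exact: flag_vvar_neq0.
Qed.
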